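(* Fix integers $x>0$ and $d\ge 4$. (a) If $x\le d$, then $\mathbb{T}(2,d;x)'=\emptyset$. (b) Let $S\subset\mathbb{P}^2$ be a set of $d+1$ points. Then $S\in\mathbb{T}(2,d;d+1)'$ if and only if $S$ is contained in a reduced conic $D$. Moreover, if $D=R\cup L$ is reducible (with $L$ and $R$ lines), then $d$ is odd, $\#(S\cap R)=\#(S\cap L)=(d+1)/2$ and $S\cap R\cap L=\emptyset$. (c) Assume $d\ge 5$. Then $\mathbb{T}(2,d;x)'=\emptyset$ for all $x$ such that $d+2\le x<3d/2$.
   Context: We work over an algebraically closed field of characteristic $0$. For a finite set $S\subset\mathbb{P}^n$, $\langle S\rangle$ is its linear span, and $2S\subset\mathbb{P}^n$ is the zero-dimensional scheme defined by the ideal sheaf $(\mathcal{I}_S)^2$ (the union of the double points supported at $S$). For a closed subscheme $Z\subset\mathbb{P}^n$, $h^i(\mathcal{I}_Z(d))=\dim H^i(\mathbb{P}^n,\mathcal{I}_Z(d))$. $\mathbb{T}(n,d;x)$ is the set of all subsets $S\subset\mathbb{P}^n$ of cardinality $x$ such that $h^0(\mathcal{I}_{2S}(d))>0$, $h^1(\mathcal{I}_{2S}(d))>0$ and $\langle S\rangle=\mathbb{P}^n$. $\mathbb{T}(n,d;x)'$ (the minimally Terracini sets) is the set of all $S\in\mathbb{T}(n,d;x)$ such that $h^1(\mathcal{I}_{2A}(d))=0$ for all $A\subsetneq S$.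
   Formalization: In (b), ''if S is contained in a reduced conic D'' is false as stated (d+1 collinear points); the converse is proved under the added condition that, when D = R∪L is reducible, d is odd, #(S∩R)=#(S∩L)=(d+1)/2 and S∩R∩L=∅. *)

(* Defs.v *)
From HB Require Import structures.
From mathcomp Require Import all_boot all_order all_algebra.
From mathcomp Require Import finmap mpoly.

Set Implicit Arguments.
Unset Strict Implicit.
Unset Printing Implicit Defensive.

Import GRing.Theory.
Local Open Scope ring_scope.
Local Open Scope fset_scope.

(* A point of P^n is a line through the origin of K^(n+1). *)
Definition projpt (K : fieldType) (n : nat) : choiceType :=
  {U : {vspace 'rV[K]_n.+1} | \dim U == 1%N}.

Definition lin_span (K : fieldType) (n : nat) (S : {fset projpt K n}) :
    {vspace 'rV[K]_n.+1} :=
  (\sum_(P <- S) val P)%VS.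

Definition vanishes_at (K : fieldType) (n : nat) (F : {mpoly K[n.+1]})
    (P : projpt K n) : Prop :=
  forall v : 'rV[K]_n.+1, v \in val P -> F.@[v ord0] = 0.

(* Over an infinite field this is the homogeneous ideal of S, since a
   polynomial vanishes on a line through 0 iff all its homogeneous components
   do. *)
Definition vanishing_ideal (K : fieldType) (n : nat) (S : {fset projpt K n})
    (F : {mpoly K[n.+1]}) : Prop :=
  forall P : projpt K n, P \in S -> vanishes_at F P.

Definition ideal_mul (A : comNzRingType) (I J : A -> Prop) (a : A) : Prop :=
  exists m (g h : 'I_m -> A),
    [/\ forall i, I (g i), forall i, J (h i) & a = \sum_i g i * h i].

(* The ideal sheaf of the scheme 2S is the sheaf associated with this
   homogeneous ideal. *)
Definition double_ideal (K : fieldType) (n : nat) (S : {fset projpt K n}) :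
    {mpoly K[n.+1]} -> Prop :=
  ideal_mul (vanishing_ideal S) (vanishing_ideal S).

(* Cohomology of the twist J~(d) of the sheaf on P^n associated with a
   homogeneous ideal J, computed as Cech cohomology of the cover by the
   U_i = {x_i != 0}; as J~(d) is quasi-coherent and the cover is affine, this
   is sheaf cohomology. All local sections live in the fraction field of
   K[x_0, ..., x_n]. Cochains are indexed by all sequences
   sigma = (i_0, ..., i_p), repetitions allowed. *)

Notation simplex n p := {ffun 'I_p.+1 -> 'I_n.+1}.

Definition face (n p : nat) (sigma : simplex n p.+1) (j : 'I_p.+2) :
    simplex n p :=
  [ffun k => sigma (lift j k)].

Notation cochain K n p := {ffun simplex n p -> {fraction {mpoly K[n.+1]}}}.

(* Sections of J~(d) over U_(i_0) /\ ... /\ U_(i_p): the degree d part of the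
   localization of J at x_(i_0) ... x_(i_p). *)
Definition is_section (K : fieldType) (n : nat) (J : {mpoly K[n.+1]} -> Prop)
    (d p : nat) (sigma : simplex n p) (s : {fraction {mpoly K[n.+1]}}) : Prop :=
  exists m (F : {mpoly K[n.+1]}),
    [/\ J F, F \is (d + m * p.+1).-homog
      & s = tofrac F / tofrac (\prod_(j < p.+1) 'X_(sigma j)) ^+ m].

Definition is_cochain (K : fieldType) (n : nat) (J : {mpoly K[n.+1]} -> Prop)
    (d p : nat) (s : cochain K n p) : Prop :=
  forall sigma : simplex n p, is_section J d sigma (s sigma).

Definition cech_diff (K : fieldType) (n p : nat) (s : cochain K n p) :
    cochain K n p.+1 :=
  [ffun sigma => \sum_(j < p.+2) (-1) ^+ j * s (face sigma j)].

Definition cocycle (K : fieldType) (n : nat) (J : {mpoly K[n.+1]} -> Prop)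
    (d p : nat) (s : cochain K n p) : Prop :=
  is_cochain J d s /\ cech_diff s = 0.

Definition coboundary (K : fieldType) (n : nat) (J : {mpoly K[n.+1]} -> Prop)
    (d p : nat) : cochain K n p -> Prop :=
  match p return cochain K n p -> Prop with
  | 0 => fun s => s = 0
  | q.+1 => fun s =>
      exists2 t : cochain K n q, is_cochain J d t & s = cech_diff t
  end.

Definition lincomb (K : fieldType) (n p k : nat) (c : 'I_k -> K)
    (e : 'I_k -> cochain K n p) : cochain K n p :=
  [ffun sigma => \sum_(i < k) tofrac (c i)%:MP * e i sigma].

(* h^p(J~(d)) >= k: some k cocycles are K-linearly independent modulo
   coboundaries. *)
Definition h_geq (K : fieldType) (n : nat) (J : {mpoly K[n.+1]} -> Prop)
    (d p k : nat) : Prop :=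
  exists2 e : 'I_k -> cochain K n p, (forall i, cocycle J d (e i)) &
    forall c : 'I_k -> K, coboundary J d (lincomb c e) -> forall i, c i = 0.

Definition h_eq (K : fieldType) (n : nat) (J : {mpoly K[n.+1]} -> Prop)
    (d p k : nat) : Prop :=
  h_geq J d p k /\ ~ h_geq J d p k.+1.

Definition terracini (K : fieldType) (n d x : nat) (S : {fset projpt K n}) :
    Prop :=
  [/\ #|` S| = x, h_geq (double_ideal S) d 0 1, h_geq (double_ideal S) d 1 1
    & lin_span S = fullv].

Definition min_terracini (K : fieldType) (n d x : nat)
    (S : {fset projpt K n}) : Prop :=
  terracini d x S /\
  forall A : {fset projpt K n}, A `<` S -> h_eq (double_ideal A) d 1 0.

(* A conic is given by its equation D; it is reduced when D has no multiple
   factor. *)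
Definition reduced_conic (K : fieldType) (D : {mpoly K[3]}) : Prop :=
  [/\ D != 0, D \is 2.-homog
    & forall G H : {mpoly K[3]}, D = G ^+ 2 * H -> (msize G <= 1)%N].

Definition contained_in (K : fieldType) (n : nat) (S : {fset projpt K n})
    (F : {mpoly K[n.+1]}) : Prop :=
  vanishing_ideal S F.

(* Lines of P^2 are 2-dimensional subspaces of K^3. *)
Definition is_line (K : fieldType) (L : {vspace 'rV[K]_3}) : Prop :=
  \dim L = 2%N.

Definition on_subspace (K : fieldType) (n : nat) (W : {vspace 'rV[K]_n.+1})
    (P : projpt K n) : bool :=
  (val P <= W)%VS.

(* Equality of point sets; for reduced D this is the equality D = R \cup L of
   schemes. *)
Definition is_union_of_lines (K : fieldType) (D : {mpoly K[3]})
    (R L : {vspace 'rV[K]_3}) : Prop :=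
  [/\ is_line R, is_line L &
    forall P : projpt K 2,
      vanishes_at D P <-> on_subspace R P \/ on_subspace L P].

Definition evenly_split (K : fieldType) (d : nat) (S : {fset projpt K 2})
    (D : {mpoly K[3]}) : Prop :=
  forall R L : {vspace 'rV[K]_3}, is_union_of_lines D R L ->
    [/\ odd d,
        #|` [fset P in S | on_subspace R P]| = (d.+1)./2,
        #|` [fset P in S | on_subspace L P]| = (d.+1)./2
      & [fset P in S | on_subspace R P && on_subspace L P] = fset0].

(* Main.v *)
Require Import Defs.
From HB Require Import structures.
From mathcomp Require Import all_boot all_order all_algebra.
From mathcomp Require Import finmap mpoly.
From mathcomp Require Import ring zify.

Set Implicit Arguments.
Unset Strict Implicit.
Unset Printing Implicit Defensive.

Import GRing.Theory.
Local Open Scope ring_scope.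

(** Why the statement holds. Let S be a set of x points.

    Cohomology. Lifting to local sections of O(d) and comparing jets shows that
    h^1 of the ideal sheaf of 2S twisted by d is positive exactly when the first
    order jets of forms of degree d at the points of S satisfy a nonzero linear
    relation: [h1_dependent]. Two ingredients are specific: the square of the ideal
    of S agrees with the ideal of forms singular along S after localization
    ([double_ideal_saturation]), and H^1(O(d)) = 0 on the plane
    ([cocycle_splits]).

    From double points to length two. A relation involves a single vector at each
    point, so it lives on a scheme Z that has length at most two at each point. If
    S is minimally Terracini, the relation involves all the points, and
    2 x < 3 d gives length Z < 3 d. The main geometric result is that the scheme of
    a relation of degree d and length below 3 d lies on a conic ([on_conic]), and
    that it lies on a line if the length is at most 2 d + 1 ([on_line]), and is
    empty if the length is at most d + 1 ([short_relation]). These are proved by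
    residuation: a form of degree e turns a relation of degree d into one of degree
    d - e on the residual scheme, and if H G contains Z, the residuals with respect
    to H and G have total length at most that of Z ([len_residual]). In the extremal
    case, length 3 d - 1 without three collinear points, a comparison of the forms
    of degree d - 1 with those containing Z concludes ([no_conic_absurd]).

    Conversely, tangent vectors give relations: on a curve of degree e, values and
    tangential derivatives at the points are functionals on the forms of degree d
    modulo the curve, whose dimension is d + 1 for a line and 2 d + 1 for a conic
    ([curve_dependent]). So d + 1 points of a conic, or (d + 2) / 2 points of a line,
    are dependent.

    Conclusion. If S is minimally Terracini and 2 x < 3 d, then S lies on a conic but
    not on a line; x is at least d + 1 by the result on lines, and at most d + 1
    since any d + 1 of the points are dependent ([min_conic]). This gives (a), (c) and
    the existence of the conic in (b). Each line has at most (d + 1) / 2 of the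
    points, which forces the even splitting. In the other direction, d + 1 points on
    the conic are dependent, and a dependent proper subset has a relation on
    length at most 2 d, hence has at least (d + 2) / 2 points on a line, which the
    even splitting forbids ([min_of_conic]). *)

(** * Linear functionals on a finite-dimensional space *)

Lemma dim_rV (K : fieldType) (n : nat) : dim 'rV[K]_n = n.
Proof. exact: mul1n. Qed.

Section Functionals.

Variables (K : fieldType) (vT : vectType K) (I : finType) (f : I -> vT -> K).
Hypothesis f_lin : forall i, linear (f i : vT -> K^o).

Definition joint_def (v : vT) : 'rV[K]_#|I| := \row_j f (enum_val j) v.

Lemma joint_linear : linear joint_def.
Proof. by move=> a u v; apply/rowP=> j; rewrite !mxE f_lin. Qed.

HB.instance Definition _ :=
  GRing.isLinear.Build K vT 'rV[K]_#|I| _ joint_def joint_linear.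

Definition joint : 'Hom(vT, 'rV[K]_#|I|) := linfun joint_def.

Lemma jointE v j : joint v 0 j = f (enum_val j) v.
Proof. by rewrite lfunE mxE. Qed.

Lemma joint_ker v : (v \in lker joint) = [forall i, f i v == 0].
Proof.
rewrite memv_ker; apply/eqP/forallP=> [v0 i|v0].
  by rewrite -[i]enum_rankK -jointE v0 mxE.
by apply/rowP=> j; rewrite jointE mxE; apply/eqP.
Qed.

Lemma joint_dim : (\dim (lker joint) + \dim (limg joint) = dim vT)%N.
Proof. by rewrite -[lker _]capfv limg_ker_dim dimvf. Qed.

Lemma joint_dim_img : (\dim (limg joint) <= #|I|)%N.
Proof. by have := dimvS (subvf (limg joint)); rewrite dimvf dim_rV. Qed.

Lemma joint_onto (b : I -> K) : (\dim (limg joint) = #|I|)%N ->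
  exists v, forall i, f i v = b i.
Proof.
move=> full; pose r : 'rV[K]_#|I| := \row_j b (enum_val j).
have: r \in limg joint.
  suff -> : limg joint = fullv by exact: memvf.
  by apply/eqP; rewrite eqEdim subvf /= full dimvf dim_rV.
move/memv_imgP=> [v _ vr]; exists v => i.
by have /rowP/(_ (enum_rank i)) := vr; rewrite jointE mxE enum_rankK.
Qed.

(** If the functionals have a larger common kernel than independent ones would,
    the image of their joint map is a proper subspace, and a coordinate vector
    orthogonal to it is a linear relation among them. *)
Lemma relation_dim : (dim vT < \dim (lker joint) + #|I|)%N ->
  exists2 c : I -> K, exists i, c i != 0 & forall v, \sum_i c i * f i v = 0.
Proof.
move=> lt_dim; have lt_img : (\dim (limg joint) < #|I|)%N.
  by move: lt_dim; rewrite -joint_dim ltn_add2l.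
pose B := \matrix_(i < \dim (limg joint)) (vbasis (limg joint))`_i.
have : kermx B^T != 0.
  rewrite kermx_eq0 /row_free; apply/negP => /eqP rB.
  by have := rank_leq_col B^T; rewrite rB leqNgt lt_img.
case/rowV0Pn => c /sub_kermxP cB c0.
exists (fun i => c 0 (enum_rank i)).
  case/rV0Pn: c0 => j cj; exists (enum_val j); by rewrite enum_valK.
move=> v; have /coord_vbasis := memv_img joint (memvf v).
move=> ev; have: c *m (joint v)^T = 0.
  rewrite ev linear_sum /= mulmx_sumr big1 // => i _.
  rewrite linearZ /= -scalemxAr; apply/eqP; rewrite scaler_eq0; apply/orP; right.
  have /matrixP/(_ 0 i) := cB; rewrite !mxE => cBi.
  apply/eqP/matrixP=> i0 j0; rewrite !ord1 !mxE -[RHS]cBi.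
  by apply: eq_bigr => k _; rewrite !mxE.
move/matrixP/(_ 0 0); rewrite !mxE (reindex enum_rank) /=; last first.
  by exists enum_val => ? _; rewrite ?enum_rankK ?enum_valK.
by under eq_bigr do rewrite mxE jointE enum_rankK.
Qed.

Lemma no_relation_onto :
    ~ (exists2 c : I -> K, exists i, c i != 0 &
         forall v, \sum_i c i * f i v = 0) ->
  (\dim (limg joint) = #|I|)%N.
Proof.
move=> norel; apply/eqP; rewrite eqn_leq joint_dim_img /= leqNgt.
apply/negP=> lt_img; apply: norel; apply: relation_dim.
by rewrite -joint_dim ltn_add2l.
Qed.

Lemma onto_no_relation (c : I -> K) : (\dim (limg joint) = #|I|)%N ->
  (forall v, \sum_i c i * f i v = 0) -> forall i, c i = 0.
Proof.
move=> full rel i; have [v fv] := joint_onto (fun k => (k == i)%:R) full.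
have := rel v; rewrite (bigD1 i) //= fv eqxx mulr1 big1 ?addr0 // => k ki.
by rewrite fv (negbTE ki) mulr0.
Qed.

Lemma common_zero (U : {vspace vT}) : (#|I| < \dim U)%N ->
  exists2 v, v \in U & v != 0 /\ forall i, f i v = 0.
Proof.
move=> lt_dim.
have: (U :&: lker joint)%VS != 0%VS.
  apply/eqP => U0; have := limg_ker_dim joint U; rewrite U0 dimv0 add0n => dU.
  have := dimvS (limgS joint (subvf U)); rewrite dU leqNgt.
  by rewrite (leq_ltn_trans joint_dim_img lt_dim).
rewrite -vpick0 => v0; have := memv_pick (U :&: lker joint).
rewrite memv_cap joint_ker => /andP[vU /forallP vf].
by exists (vpick (U :&: lker joint)) => //; split=> // i; apply/eqP.
Qed.

End Functionals.

(** * Evaluation, directional derivatives and linear forms *)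

Section Evaluation.

Variables (K : fieldType) (n : nat).
Implicit Types (F G : {mpoly K[n.+1]}) (u v w : 'rV[K]_n.+1).

Definition ev v F : K := F.@[v ord0].

Definition dder w v F : K := \sum_k w ord0 k * ev v F^`M(k).

Lemma ev_linear v : linear (ev v : {mpoly K[n.+1]} -> K^o).
Proof. by move=> a F G; rewrite /ev mevalD mevalZ. Qed.

Lemma dder_linear w v : linear (dder w v : {mpoly K[n.+1]} -> K^o).
Proof.
move=> a F G; rewrite /dder scaler_sumr -big_split /=; apply: eq_bigr => k _.
by rewrite mderivD mderivZ ev_linear mulrDr mulrCA.
Qed.

Lemma ev0 v : ev v 0 = 0. Proof. exact: meval0. Qed.
Lemma evD v F G : ev v (F + G) = ev v F + ev v G. Proof. exact: mevalD. Qed.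
Lemma evB v F G : ev v (F - G) = ev v F - ev v G. Proof. exact: mevalB. Qed.
Lemma evM v F G : ev v (F * G) = ev v F * ev v G. Proof. exact: mevalM. Qed.
Lemma evZ v c F : ev v (c *: F) = c * ev v F. Proof. exact: mevalZ. Qed.
Lemma evX v F k : ev v (F ^+ k) = ev v F ^+ k.
Proof. exact: rmorphXn. Qed.
Lemma evXi v i : ev v 'X_i = v 0 i. Proof. exact: mevalXU. Qed.

Lemma ev_sum v (J : Type) (r : seq J) (P : pred J) (H : J -> {mpoly K[n.+1]}) :
  ev v (\sum_(j <- r | P j) H j) = \sum_(j <- r | P j) ev v (H j).
Proof. exact: raddf_sum. Qed.

Lemma dderM w v F G :
  dder w v (F * G) = ev v F * dder w v G + dder w v F * ev v G.
Proof.
rewrite /dder mulr_sumr mulr_suml -big_split /=; apply: eq_bigr => k _.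
by rewrite mderivM evD !evM; ring.
Qed.

Lemma dderD w v F G : dder w v (F + G) = dder w v F + dder w v G.
Proof. by have := dder_linear w v 1 F G; rewrite !scale1r. Qed.

Lemma dderZ w v c F : dder w v (c *: F) = c * dder w v F.
Proof.
have := dder_linear w v c F 0; rewrite !addr0 => ->.
rewrite [X in _ + X](_ : _ = 0) ?addr0 // /dder big1 // => k _.
by rewrite mderiv0 ev0 mulr0.
Qed.

Lemma dderB w v F G : dder w v (F - G) = dder w v F - dder w v G.
Proof. by rewrite dderD -scaleN1r dderZ mulN1r. Qed.

Lemma dder_dirD u w v F : dder (u + w) v F = dder u v F + dder w v F.
Proof. by rewrite /dder -big_split; apply: eq_bigr => k _; rewrite mxE mulrDl. Qed.

Lemma dder_dirZ c w v F : dder (c *: w) v F = c * dder w v F.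
Proof. by rewrite /dder mulr_sumr; apply: eq_bigr => k _; rewrite mxE mulrA. Qed.

Lemma dder_dir0 v F : dder 0 v F = 0.
Proof. by rewrite /dder big1 // => k _; rewrite mxE mul0r. Qed.

(** Euler's formula lets the first partial derivatives of a form carry its value
    as well, so a jet is a vector of partial derivatives. *)
Lemma euler d v F : F \is d.-homog -> dder v v F = d%:R * ev v F.
Proof.
move/dhomogP=> hF; rewrite [F]mpolyE.
rewrite ev_sum mulr_sumr.
have -> : dder v v (\sum_(m <- msupp F) F@_m *: 'X_[m]) =
          \sum_(m <- msupp F) dder v v (F@_m *: 'X_[m]).
  elim: (msupp F) => [|m s IH]; last by rewrite !big_cons dderD IH.
  by rewrite !big_nil; have := dderZ v v 0 0; rewrite scaler0 mul0r.
apply: eq_big_seq => m /hF md; have {}md : mdeg m = d := md.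
rewrite dderZ evZ mulrCA; congr (_ * _).
rewrite -[in RHS]md mdegE natr_sum mulr_suml; apply: eq_bigr => k _.
rewrite mderivX evZ mulrCA; case: (posnP (m k)) => [->|mk0].
  by rewrite !mul0r.
congr (_ * _); rewrite -evXi -evM -mpolyXD.
by rewrite addmC submK // lep1mP -lt0n.
Qed.

Lemma ev_scale d c v F : F \is d.-homog -> ev (c *: v) F = c ^+ d * ev v F.
Proof.
move/dhomogP=> hF; rewrite [F]mpolyE !ev_sum mulr_sumr.
apply: eq_big_seq => m /hF md; have {}md : mdeg m = d := md.
rewrite !evZ mulrCA; congr (_ * _).
rewrite /ev !mevalX -[in RHS]md mdegE -prodrXr -big_split /=.
by apply: eq_bigr => k _; rewrite mxE exprMn.
Qed.

Lemma dderXi w v i : dder w v 'X_i = w 0 i.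
Proof.
rewrite /dder (bigD1 i) //= mderivX mnmE eqxx evZ mulr1n mul1r.
rewrite [(_ - _)%MM](_ : _ = 0%MM); last first.
  by apply/mnmP=> k; rewrite mnmBE subnn mnm0E.
rewrite mpolyX0 [ev v 1]meval1 mulr1 big1 ?addr0 // => k ki.
by rewrite mderivX mnmE eq_sym (negbTE ki) scale0r ev0 mulr0.
Qed.

Lemma dderX w v F k :
  dder w v (F ^+ k) = k%:R * ev v F ^+ k.-1 * dder w v F.
Proof.
elim: k => [|k IH]; last first.
  rewrite exprS dderM IH evX; case: k {IH} => [|k].
    by rewrite !mul0r mulr0 add0r !expr0 mulr1 !mul1r.
  by rewrite ![_.+1.-1]/= (exprS _ k) -[k.+2]addn1 natrD; ring.
rewrite expr0 !mul0r /dder big1 // => i _.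
by rewrite -mpolyC1 mderivC ev0 mulr0.
Qed.

End Evaluation.

Section LinearForms.
Variables (K : fieldType) (n : nat).

Definition linform (c : 'rV[K]_n.+1) : {mpoly K[n.+1]} := \sum_k c 0 k *: 'X_k.

Lemma linform_homog c : linform c \is 1.-homog.
Proof. by rewrite rpred_sum // => k _; rewrite rpredZ // dhomogX /= mdeg1. Qed.

Lemma ev_linform c v : ev v (linform c) = \sum_k c 0 k * v 0 k.
Proof. by rewrite /linform ev_sum; apply: eq_bigr => k _; rewrite evZ evXi. Qed.

Lemma dder_linform c w v : dder w v (linform c) = ev w (linform c).
Proof.
rewrite /linform ev_sum; elim: (index_enum _) => [|k s IH].
  by rewrite !big_nil; have := dderZ w v 0 0; rewrite scaler0 mul0r.
by rewrite !big_cons dderD IH dderZ dderXi evZ evXi.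
Qed.

Lemma mcoeff_linform c k : (linform c)@_U_(k) = c 0 k.
Proof.
rewrite /linform raddf_sum (bigD1 k) //= mcoeffZ mcoeffXU eqxx mulr1.
by rewrite big1 ?addr0 // => j jk; rewrite mcoeffZ mcoeffXU (negbTE jk) mulr0.
Qed.

Lemma linform_eq0 c : (linform c == 0) = (c == 0).
Proof.
apply/eqP/eqP => [c0|->].
  by apply/rowP=> k; rewrite -mcoeff_linform c0 mcoeff0 mxE.
by rewrite /linform big1 // => k _; rewrite mxE scale0r.
Qed.

Lemma homog1_linform F : F \is 1.-homog ->
  exists c, F = linform c :> {mpoly K[n.+1]}.
Proof.
move=> hF; exists (\row_k F@_U_(k)); apply/mpolyP => m.
have [/eqP/mdeg1P [k /eqP ->]|m1] := eqVneq (mdeg m) 1%N.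
  by rewrite mcoeff_linform mxE.
by rewrite (dhomog_nemf_coeff hF m1) (dhomog_nemf_coeff (linform_homog _) m1).
Qed.

Lemma dder_hom1 F (w v : 'rV[K]_n.+1) : F \is 1.-homog -> dder w v F = ev w F :> K.
Proof. by case/homog1_linform=> c ->; exact: dder_linform. Qed.

(** A column of the cokernel of A is a linear form on the quotient by the row
    space of A. *)
Lemma separating_form m (A : 'M[K]_(m, n.+1)) (v : 'rV[K]_n.+1) :
  ~~ (v <= A)%MS -> exists L : {mpoly K[n.+1]},
    [/\ L \is 1.-homog, ev v L != 0 &
        forall u : 'rV[K]_n.+1, (u <= A)%MS -> ev u L = 0].
Proof.
rewrite submxE => /matrix0Pn [i [j vj]].
exists (linform (col j (cokermx A))^T); split; first exact: linform_homog.
  rewrite ev_linform; move: vj; rewrite !mxE ord1; apply: contraNN => /eqP e0.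
  by apply/eqP; rewrite -[RHS]e0; apply: eq_bigr => k _; rewrite !mxE mulrC.
move=> u; rewrite submxE => /eqP /matrixP /(_ 0 j); rewrite !mxE => <-.
by rewrite ev_linform; apply: eq_bigr => k _; rewrite !mxE mulrC.
Qed.

Lemma separating_linform (u v : 'rV[K]_n.+1) : ~~ (v <= u)%MS ->
  exists L : {mpoly K[n.+1]}, [/\ L \is 1.-homog, ev u L = 0 & ev v L != 0].
Proof.
by case/separating_form=> L [L1 Lv Lu]; exists L; split=> //; apply: Lu.
Qed.

Lemma nonvanishing_linform (v : 'rV[K]_n.+1) : v != 0 ->
  exists2 L : {mpoly K[n.+1]}, L \is 1.-homog & ev v L != 0.
Proof.
move=> v0; have: ~~ (v <= (0%R : 'M[K]_n.+1))%MS by rewrite submx0.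
by case/separating_form=> L [L1 Lv _]; exists L.
Qed.

End LinearForms.

(** * Forms of a given degree and their linear conditions *)

Section Division.

Variables (K : fieldType) (n : nat).
Implicit Types (A B E F G L : {mpoly K[n.+1]}).

(** Induction along the ring generators, for statements about substitution that
    are compatible with products but awkward on monomials. *)
Lemma mpoly_ring_ind (P : {mpoly K[n.+1]} -> Prop) :
    (forall c, P c%:MP) -> (forall i, P 'X_i) ->
    (forall F G, P F -> P G -> P (F + G)) ->
    (forall F G, P F -> P G -> P (F * G)) ->
  forall F, P F.
Proof.
move=> PC PX PD PM F; rewrite [F]mpolyE.
apply: (big_ind P) => // [|m _]; first by rewrite -mpolyC0.
rewrite -mul_mpolyC mpolyXE_id; apply: (PM) => //.
apply: (big_ind P) => // [|i _]; first by rewrite -mpolyC1.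
by elim: (m i) => [|k IH]; rewrite ?expr0 -?mpolyC1 // exprS; apply: PM.
Qed.

Lemma pihomogM d e E B : E \is e.-homog ->
  pihomog mdeg (d + e) (E * B) = E * pihomog mdeg d B.
Proof.
move=> hE; pose k := maxn (msize B) d.+1.
have EB := @pihomog_partitionE _ _ mdeg k B (leq_maxl _ _).
rewrite [in LHS]EB mulr_sumr raddf_sum /=.
have dk : (d < k)%N by rewrite leq_max leqnn orbT.
have hom j : E * pihomog mdeg j B \is (j + e).-homog.
  by rewrite addnC dhomogM // pihomogP.
rewrite (bigD1 (Ordinal dk)) //= pihomog_dE // big1 ?addr0 // => j jd.
by apply: (pihomog_ne0 _ (hom j)); rewrite eqn_add2r.
Qed.

Lemma homog_quotient d e E B : E \is e.-homog -> E != 0 ->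
  E * B \is (d + e).-homog -> B \is d.-homog.
Proof.
move=> hE E0 hEB; suff -> : B = pihomog mdeg d B by exact: pihomogP.
by apply: (mulfI E0); rewrite -(pihomogM _ _ hE) pihomog_dE.
Qed.

(** Solving L = 0 for one variable is a substitution morphism with kernel (L);
    the target being a domain, (L) is prime. *)
Lemma linear_form_prime L A B C : L \is 1.-homog -> L != 0 ->
  A * B = L * C -> (exists A', A = L * A') \/ (exists B', B = L * B').
Proof.
case/homog1_linform=> c ->; rewrite linform_eq0 => /rV0Pn [i ci].
set L' := linform c; pose phi k := 'X_k - (k == i)%:R *: ((c 0 i)^-1 *: L').
pose f := [tuple phi k | k < n.+1].
have fX k : 'X_k \mPo f = phi k.
  by rewrite comp_mpolyXU -tnth_nth tnth_mktuple.
have fL : L' \mPo f = 0.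
  rewrite /L' /linform raddf_sum /=.
  under eq_bigr do rewrite linearZ /= fX scalerBr.
  rewrite big_split sumrN /= -/(linform c) -/L' [X in _ - X](bigD1 i) //= big1.
    by rewrite eqxx scale1r scalerA divff // scale1r addr0 subrr.
  by move=> k ki; rewrite (negbTE ki) scale0r scaler0.
(* The substitution is the identity modulo L. *)
have fE F : exists G, F = F \mPo f + L' * G.
  elim/mpoly_ring_ind: F => [a|k|F G [F1 eF] [G1 eG]|F G [F1 eF] [G1 eG]].
  - by exists 0; rewrite comp_mpolyC mulr0 addr0.
  - exists ((k == i)%:R *: ((c 0 i)^-1)%:MP).
    rewrite fX /phi -scalerAr -[X in _ + _ *: X]mulrC mul_mpolyC.
    by rewrite subrK.
  - exists (F1 + G1); rewrite {1}eF {1}eG comp_mpolyD; ring.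
  - exists (F1 * (G \mPo f) + (F \mPo f) * G1 + L' * F1 * G1).
    by rewrite {1}eF {1}eG rmorphM /=; ring.
move=> AB; have : (A \mPo f) * (B \mPo f) = 0.
  by rewrite -rmorphM /= AB rmorphM /= fL mul0r.
move/eqP; rewrite mulf_eq0 => /orP [] /eqP f0; [left|right].
  by have [A' ->] := fE A; exists A'; rewrite f0 add0r.
by have [B' ->] := fE B; exists B'; rewrite f0 add0r.
Qed.

End Division.

Section Forms.

Variables (K : fieldType) (n : nat).
Implicit Types (E F G : {mpoly K[n.+1]}).

Lemma dim_forms d : dim (dhomog n.+1 K d) = 'C(d + n, d).
Proof. by []. Qed.

Section Multiplication.

Variables (e d k : nat) (E : {mpoly K[n.+1]}).
Hypotheses (hE : E \is e.-homog) (dk : (d + e)%N = k).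

Lemma mulform_homog (A : dhomog n.+1 K d) : val A * E \is k.-homog.
Proof. by rewrite -dk; apply: dhomogM hE; exact: dhomog_is_dhomog. Qed.

Definition mulform_def (A : dhomog n.+1 K d) : dhomog n.+1 K k :=
  DHomog (mulform_homog A).

Lemma mulform_linear : linear mulform_def.
Proof. by move=> a A B; apply/val_inj; rewrite /= mulrDl -scalerAl. Qed.

HB.instance Definition _ :=
  GRing.isLinear.Build K (dhomog n.+1 K d) (dhomog n.+1 K k) _ mulform_def
    mulform_linear.

Definition mulform : 'Hom(dhomog n.+1 K d, dhomog n.+1 K k) := linfun mulform_def.

Lemma mulformE A : val (mulform A) = val A * E.
Proof. by rewrite lfunE. Qed.

Lemma mem_limg_mulform (F : dhomog n.+1 K k) :
  reflect (exists2 A, A \is d.-homog & val F = A * E) (F \in limg mulform).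
Proof.
apply: (iffP memv_imgP) => [[A _ ->]|[A hA FA]].
  by exists (val A); [exact: dhomog_is_dhomog | exact: mulformE].
exists (DHomog hA); first exact: memvf.
by apply/val_inj/(etrans FA)/esym/mulformE.
Qed.

Lemma dim_limg_mulform : E != 0 -> \dim (limg mulform) = 'C(d + n, d).
Proof.
move=> E0; rewrite limg_dim_eq ?dimvf //; apply/eqP; rewrite -subv0.
apply/subvP=> A; rewrite memv_cap memvf memv_ker => /eqP A0.
have : val A * E = 0 by rewrite -mulformE A0.
by move/eqP; rewrite mulf_eq0 (negbTE E0) orbF memv0.
Qed.

End Multiplication.

Variables (I : finType) (f : I -> {mpoly K[n.+1]} -> K).
Hypothesis f_lin : forall i, linear (f i : {mpoly K[n.+1]} -> K^o).

Definition related k (c : I -> K) :=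
  forall F, F \is k.-homog -> \sum_i c i * f i F = 0.

Let g k i (F : dhomog n.+1 K k) := f i (val F).

Let g_lin k i : linear (@g k i : dhomog n.+1 K k -> K^o).
Proof. by move=> a F G; rewrite /g /= f_lin. Qed.

Lemma form_common_zero k : (#|I| < 'C(k + n, k))%N ->
  exists F, [/\ F \is k.-homog, F != 0 & forall i, f i F = 0].
Proof.
move=> lt_dim; have := common_zero (@g_lin k) (U := fullv).
rewrite dimvf => /(_ lt_dim) [F _ [F0 gF]].
by exists (val F); split=> //; exact: dhomog_is_dhomog.
Qed.

Lemma form_common_zero_dec k :
  (exists F, [/\ F \is k.-homog, F != 0 & forall i, f i F = 0]) \/
  (forall F, F \is k.-homog -> (forall i, f i F = 0) -> F = 0).
Proof.
have [ker0|] := eqVneq (lker (joint (@g k))) 0%VS; [right=> F hF fF|].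
  have : DHomog hF \in lker (joint (@g k)).
    by rewrite (joint_ker (@g_lin k)); apply/forallP=> i; apply/eqP/fF.
  by rewrite ker0 memv0 => /eqP/(congr1 val).
rewrite -vpick0 => F0; left; have := memv_pick (lker (joint (@g k))).
rewrite (joint_ker (@g_lin k)) => /forallP gF.
exists (val (vpick (lker (joint (@g k))))).
by split=> // [|j]; [exact: dhomog_is_dhomog | exact/eqP/gF].
Qed.

(** The form is found in a complement of the multiples of E. *)
Lemma form_common_zero_mod e d k E : E \is e.-homog -> E != 0 ->
    (d + e)%N = k -> (#|I| + 'C(d + n, d) < 'C(k + n, k))%N ->
  exists F, [/\ F \is k.-homog, forall i, f i F = 0 &
                ~ exists2 A, A \is d.-homog & F = A * E].
Proof.
move=> hE E0 dk lt_dim; pose U := (limg (mulform hE dk))^C%VS.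
have : (#|I| < \dim U)%N.
  by rewrite dimv_compl dim_limg_mulform // dimvf dim_forms ltn_subRL addnC.
case/(common_zero (@g_lin k)) => F FU [F0 gF].
exists (val F); split=> // [|FE]; first exact: dhomog_is_dhomog.
case/negP: F0; rewrite -memv0.
rewrite -(capv_compl (limg (mulform hE dk))) memv_cap FU andbT.
by apply/mem_limg_mulform.
Qed.

(** In the quotient by U there is not enough room for the functionals to be
    independent. *)
Lemma related_of_kernel k (U : {vspace dhomog n.+1 K k}) :
    (forall F : dhomog n.+1 K k, F \in U -> forall i, f i (val F) = 0) ->
    ('C(k + n, k) < \dim U + #|I|)%N ->
  exists2 c, exists i, c i != 0 & related k c.
Proof.
move=> fU lt_dim; have : (dim (dhomog n.+1 K k) <
    \dim (lker (joint (@g k))) + #|I|)%N.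
  apply: leq_trans lt_dim _; rewrite leq_add2r; apply: dimvS.
  apply/subvP => F FU; rewrite (joint_ker (@g_lin k)).
  by apply/forallP=> i; apply/eqP/fU.
case/(relation_dim (@g_lin k)) => c c0 cg; exists c => // F hF.
exact: cg (DHomog hF).
Qed.

(** As many functionals as the dimension: if they are related, their joint map is
    not onto, hence not injective. *)
Lemma related_common_zero k (c : I -> K) : (exists i, c i != 0) ->
    related k c -> (#|I| <= 'C(k + n, k))%N ->
  exists F, [/\ F \is k.-homog, F != 0 & forall i, f i F = 0].
Proof.
move=> [i ci] crel; rewrite leq_eqVlt => /orP[/eqP cardI|]; last first.
  exact: form_common_zero.
have [//|none] := form_common_zero_dec k.
have full : \dim (limg (joint (@g k))) = #|I|.
  have ker0 : lker (joint (@g k)) = 0%VS.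
    apply/eqP; rewrite -subv0; apply/subvP=> F.
    rewrite (joint_ker (@g_lin k)) memv0 => /forallP gF.
    apply/eqP/val_inj/none => [|j]; [exact: dhomog_is_dhomog | exact/eqP/gF].
  by have := joint_dim (@g k); rewrite ker0 dimv0 add0n dim_forms => ->.
case/eqP: ci; apply: (onto_no_relation (@g_lin k) full) => F.
exact: crel (dhomog_is_dhomog F).
Qed.

Lemma related_dec k : (exists2 c, exists i, c i != 0 & related k c) \/
  ~ (exists2 c, exists i, c i != 0 & related k c).
Proof.
have [lt_img|full] := ltnP (\dim (limg (joint (@g k)))) #|I|.
  left; have : (dim (dhomog n.+1 K k) < \dim (lker (joint (@g k))) + #|I|)%N.
    by rewrite -(joint_dim (@g k)) ltn_add2l.
  case/(relation_dim (@g_lin k)) => c c0 cg; exists c => // F hF.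
  exact: cg (DHomog hF).
right=> -[c [i ci] crel]; case/eqP: ci.
have {}full : \dim (limg (joint (@g k))) = #|I|.
  by apply/eqP; rewrite eqn_leq joint_dim_img.
by apply: (onto_no_relation (@g_lin k) full) => F; exact: crel (dhomog_is_dhomog F).
Qed.

Lemma unrelated_onto k (b : I -> K) :
    ~ (exists2 c, exists i, c i != 0 & related k c) ->
  exists2 F, F \is k.-homog & forall i, f i F = b i.
Proof.
move=> norel; have full : \dim (limg (joint (@g k))) = #|I|.
  apply: no_relation_onto (@g_lin k) _ => -[c c0 crel].
  by apply: norel; exists c => // F hF; exact: crel (DHomog hF).
have [F gF] := joint_onto (@g_lin k) b full; exists (val F) => //.
exact: dhomog_is_dhomog.
Qed.

(** The multiples of E already fill the common kernel of independent
    functionals, for dimension reasons. *)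
Lemma unrelated_multiple e d k E F : E \is e.-homog -> E != 0 ->
    (d + e)%N = k -> ('C(d + n, d) + #|I|)%N = 'C(k + n, k) ->
    ~ (exists2 c, exists i, c i != 0 & related k c) ->
    (forall A, A \is d.-homog -> forall i, f i (A * E) = 0) ->
    F \is k.-homog -> (forall i, f i F = 0) ->
  exists2 A, A \is d.-homog & F = A * E.
Proof.
move=> hE E0 dk dims norel fE hF fF.
have full : \dim (limg (joint (@g k))) = #|I|.
  apply: no_relation_onto (@g_lin k) _ => -[c c0 crel].
  by apply: norel; exists c => // G hG; exact: crel (DHomog hG).
have sub : (limg (mulform hE dk) <= lker (joint (@g k)))%VS.
  apply/subvP=> G /mem_limg_mulform [A hA GA]; rewrite (joint_ker (@g_lin k)).
  by apply/forallP=> i; rewrite /g GA fE.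
have /eqP eqU : limg (mulform hE dk) == lker (joint (@g k)).
  rewrite eqEdim sub dim_limg_mulform //=.
  by rewrite -(leq_add2r #|I|) dims -[in X in (_ + X <= _)%N]full joint_dim.
suff : DHomog hF \in limg (mulform hE dk) by move/mem_limg_mulform.
rewrite eqU joint_ker; last exact: g_lin.
by apply/forallP=> i; apply/eqP/fF.
Qed.

End Forms.

(** * Weights on points with tangent directions *)

(** The profile of a subscheme of prescribed length u. *)
Lemma sub_profile (I : finType) (m : I -> nat) u : (u <= \sum_i m i)%N ->
  exists2 l : I -> nat, forall i, (l i <= m i)%N & (\sum_i l i)%N = u.
Proof.
elim: u => [|u IH] lt_u; first by exists (fun=> 0%N) => //; rewrite big1.
have [l lm lu] := IH (ltnW lt_u).
have [i li] : exists i, (l i < m i)%N.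
  apply/existsP; apply: contraLR lt_u; rewrite negb_exists => /forallP ml.
  by rewrite -leqNgt -lu leq_sum // => i _; rewrite leqNgt.
exists (fun j => l j + (j == i))%N => [j|].
  by case: eqP => [->|_]; rewrite ?addn1 ?addn0.
rewrite big_split /= lu (bigD1 i) //= eqxx big1 ?addn0 ?addn1 // => j ji.
by rewrite (negbTE ji).
Qed.

Section Weights.

Variables (K : fieldType) (I : finType) (p t : I -> 'rV[K]_3).

Implicit Types (F G H L C : {mpoly K[3]}) (s r : I -> K * K).

(** A weight (a, b) at the point p i with direction t i stands for the functional
    a F(p) + b (dF/dt)(p). Such functionals form the dual of the functions on the
    length two scheme at p i in the direction t i, that is, the dual of the dual
    numbers, and a form acts on them by multiplication of the argument. *)
Definition act H s i : K * K :=
  ((s i).1 * ev (p i) H + (s i).2 * dder (t i) (p i) H, (s i).2 * ev (p i) H).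

(** The length of the smallest subscheme that the functional of the weight factors
    through. *)
Definition local_len (x : K * K) : nat := if x.2 != 0 then 2%N else x.1 != 0.

Definition len s : nat := (\sum_i local_len (s i))%N.

Definition pairing s F : K :=
  \sum_i ((s i).1 * ev (p i) F + (s i).2 * dder (t i) (p i) F).

Definition relation k s := forall F, F \is k.-homog -> pairing s F = 0.

Definition vanishes_to (l : I -> nat) F := forall i,
  ((0 < l i)%N -> ev (p i) F = 0) /\ ((1 < l i)%N -> dder (t i) (p i) F = 0).

Lemma local_len_le2 x : (local_len x <= 2)%N.
Proof. by rewrite /local_len; case: ifP => // _; case: (_ == _). Qed.

Lemma local_len_eq0 x : (local_len x == 0%N) = (x == (0, 0)).
Proof.
by case: x => a b; rewrite /local_len xpair_eqE /=; case: (b == 0); case: (a == 0).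
Qed.

Lemma len_eq0P s : reflect (forall i, s i = (0, 0)) (len s == 0%N).
Proof.
rewrite /len sum_nat_eq0; apply: (iffP forallP) => s0 i.
  by apply/eqP; rewrite -local_len_eq0 (implyP (s0 i)).
by rewrite local_len_eq0 s0 eqxx implybT.
Qed.

Lemma len_gt0P s : reflect (exists i, local_len (s i) != 0%N) (0 < len s)%N.
Proof.
apply: (iffP idP) => [|[i si]].
  rewrite lt0n /len sum_nat_eq0 negb_forall => /existsP [i]; rewrite negb_imply.
  by case/andP=> _ si; exists i.
by rewrite lt0n /len sum_nat_eq0 negb_forall; apply/existsP; exists i.
Qed.

Lemma act_act G H s i : act H (act G s) i = act (H * G) s i.
Proof. by rewrite /act /= dderM !evM; congr (_, _); ring. Qed.

Lemma len_act_act G H s : len (act H (act G s)) = len (act (H * G) s).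
Proof. by apply: eq_bigr => i _; rewrite act_act. Qed.

Lemma pairing_act H s F : pairing (act H s) F = pairing s (H * F).
Proof.
by apply: eq_bigr => i _; rewrite /act /= dderM !evM; ring.
Qed.

Lemma relation_act k e H s : H \is e.-homog ->
  relation (k + e) s -> relation k (act H s).
Proof.
by move=> hH rs F hF; rewrite pairing_act rs // addnC dhomogM.
Qed.

Lemma vanishes_local_len l F s i : vanishes_to l F ->
  (l i <= local_len (s i))%N ->
  (local_len (act F s i) + l i <= local_len (s i))%N.
Proof.
case/(_ i); rewrite /act /local_len /=; case: (s i) => a b /=.
case: (l i) => [|[|[|k]]] F0 F1.
- rewrite addn0 => _; have [->|b0] := eqVneq b 0; last first.
    by case: ifP => // _; case: (_ == _).
  have [->|a0] := eqVneq a 0; rewrite !mul0r addr0 eqxx //=.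
  by case: (_ == _).
- by rewrite F0 // !mulr0 eqxx add0r /=; case: (b =P 0) => [->|_];
     rewrite ?mul0r ?eqxx //=; case: (_ == _).
- by rewrite F0 // F1 // !mulr0 addr0 eqxx.
- by case: (_ != _) => //; case: (_ != _).
Qed.

Lemma len_vanishing l F s : vanishes_to l F ->
    (forall i, l i <= local_len (s i))%N ->
  (len (act F s) + \sum_i l i <= len s)%N.
Proof.
move=> Fl ls; rewrite /len -big_split leq_sum // => i _.
exact: vanishes_local_len.
Qed.

Lemma killed_vanishes F s : len (act F s) = 0%N ->
  vanishes_to (fun i => local_len (s i)) F.
Proof.
move/eqP/len_eq0P=> Fs i; have /eqP := Fs i; rewrite /act xpair_eqE /local_len.
case: (s i) => a b /=; case: (b =P 0) => [-> |/eqP b0] /=.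
  rewrite !mul0r addr0 eqxx andbT; case: (a =P 0) => //= /eqP a0.
  by rewrite mulf_eq0 (negbTE a0) => /eqP.
case/andP; rewrite [b * _ == 0]mulf_eq0 (negbTE b0) /= => + /eqP F0.
by rewrite F0 mulr0 add0r mulf_eq0 (negbTE b0) => /eqP.
Qed.

Lemma vanishes_killed F s : vanishes_to (fun i => local_len (s i)) F ->
  len (act F s) = 0%N.
Proof.
move=> Fs; have := len_vanishing Fs (fun=> leqnn _); rewrite -/(len s).
by rewrite -[X in (_ <= X)%N]add0n leq_add2r leqn0 => /eqP.
Qed.

(** The residual scheme with respect to H loses the length of any subscheme
    contained in the curve H = 0; the scheme of r is one. *)
Lemma len_killed H r s : len (act H r) = 0%N ->
    (forall i, local_len (r i) <= local_len (s i))%N ->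
  (len (act H s) + len r <= len s)%N.
Proof. by move=> /killed_vanishes Hr; apply: len_vanishing. Qed.

Lemma local_len_act H s i : (local_len (act H s i) <= local_len (s i))%N.
Proof.
have := @vanishes_local_len (fun=> 0%N) H s i (fun=> conj _ _).
by rewrite addn0; apply=> //.
Qed.

Lemma len_act H s : (len (act H s) <= len s)%N.
Proof. by apply: leq_sum => i _; apply: local_len_act. Qed.

(** If the product H G contains the scheme, its residuals with respect to the two
    factors fit side by side inside it. All the residuation below is this
    inequality. *)
Lemma len_residual G H s : len (act (H * G) s) = 0%N ->
  (len (act H s) + len (act G s) <= len s)%N.
Proof.
rewrite -len_act_act => /len_killed; apply=> i; exact: local_len_act.
Qed.

Lemma act_neq0 H s i : local_len (s i) != 0%N -> ev (p i) H != 0 ->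
  local_len (act H s i) != 0%N.
Proof.
rewrite !local_len_eq0 /act; case: (s i) => a b /=; rewrite !xpair_eqE /=.
case: (b =P 0) => [->|/eqP b0] s0 Hp; last first.
  by rewrite [b * _ == 0]mulf_eq0 (negbTE b0) (negbTE Hp) andbF.
move: s0; rewrite andbT !mul0r eqxx andbT addr0 => a0.
by rewrite mulf_eq0 (negbTE a0).
Qed.

Section Independent.

Hypotheses (p_neq0 : forall i, p i != 0)
  (p_inj : forall i j, i != j -> ~~ (p i <= p j)%MS)
  (t_indep : forall i, ~~ (t i <= p i)%MS).

Lemma vanishes_at_one L j : ev (p j) L = 0 ->
  vanishes_to (fun i => (i == j) : nat) L.
Proof. by move=> Lj i; case: eqP => [->|]. Qed.

(** A scheme of length at most k + 1 imposes independent conditions on forms of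
    degree k. Multiplying by a line that cuts the scheme without containing it
    lowers both the degree and the length; such a line separates two points of the
    scheme, or passes through its only point transversally. If the length is at
    most k already, a line avoiding one point is enough. *)
Lemma short_relation k s : relation k s -> (len s <= k.+1)%N -> len s = 0%N.
Proof.
elim: k s => [|k IH] s rs len_s; apply/eqP; rewrite eqn0Ngt.
  apply/negP => /len_gt0P [i si].
  have := rs 1 (dhomog1 _ _); rewrite /pairing (bigD1 i) //=.
  have s1 : local_len (s i) = 1%N.
    apply/eqP; rewrite eqn_leq lt0n si andbT.
    by rewrite /len (bigD1 i) //= in len_s; apply: leq_trans len_s; apply: leq_addr.
  move: len_s; rewrite /len (bigD1 i) //= s1 add1n ltnS leqn0 sum_nat_eq0.
  move/forallP=> s0.
  rewrite big1 ?addr0; last first.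
    move=> j /(implyP (s0 j)); rewrite local_len_eq0 => /eqP -> /=.
    by rewrite !mul0r addr0.
  rewrite /ev meval1 mulr1; move: s1; rewrite /local_len.
  case: (s i) => a b /=; have [->|//] := eqVneq b 0; rewrite mul0r addr0.
  by move=> /= a1 a0; rewrite a0 eqxx in a1.
apply/negP => /len_gt0P [i si].
have contra L : L \is 1.-homog -> local_len (act L s i) != 0%N ->
    (len (act L s) <= k.+1)%N -> False.
  move=> hL Li lenL; have := IH (act L s); rewrite -addn1 in rs.
  move=> /(_ (relation_act hL rs) lenL) /eqP /len_eq0P /(_ i) /eqP.
  by rewrite -local_len_eq0; apply/negP.
have [len_s'|len_s'] := leqP (len s) k.+1.
  have [L hL Li] := nonvanishing_linform (p_neq0 i).
  apply: (contra L hL); first exact: act_neq0.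
  exact: leq_trans (len_act _ _) _.
have cut L j : ev (p j) L = 0 -> local_len (s j) != 0%N ->
    (len (act L s) <= k.+1)%N.
  move=> Lj sj; have := len_vanishing (s := s) (vanishes_at_one Lj).
  rewrite (bigD1 j) //= eqxx big1 => [|i' /negbTE -> //].
  rewrite addn0 addn1 => lenL; rewrite -ltnS; apply: leq_trans (lenL _) len_s.
  by move=> i'; case: eqP => // ->; rewrite lt0n.
(* Either a second point j to cut with, or the whole length sits at i. *)
have [[j ji sj]|only] : (exists2 j, i != j & local_len (s j) != 0%N) \/
    forall j, i != j -> local_len (s j) = 0%N.
  case: (altP (@existsP _ (fun j => (i != j) && (local_len (s j) != 0%N)))).
    by case=> j /andP[]; left; exists j.
  rewrite negb_exists => /forallP none; right=> j ij.
  by have := none j; rewrite ij negbK => /eqP.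
  have [L [hL Lj Li]] := separating_linform (p_inj ji).
  by apply: (contra L hL); [exact: act_neq0 | exact: cut Lj sj].
have [L [hL Lp Lt]] := separating_linform (t_indep i).
apply: (contra L hL); last exact: cut Lp si.
have : local_len (s i) = 2%N.
  apply/eqP; rewrite eqn_leq local_len_le2 /=.
  suff -> : local_len (s i) = len s by apply: leq_trans len_s'.
  by rewrite /len (bigD1 i) //= big1 ?addn0 // => j; rewrite eq_sym => /only.
rewrite /act /local_len Lp (dder_hom1 _ _ hL) !mulr0 add0r eqxx /=.
case: ifP => [b0 _|_]; last by case: (_ == _).
by rewrite mulf_neq0.
Qed.

End Independent.
End Weights.

(** * Dimension counts for weight relations *)

Section Schemes.

Variables (K : fieldType) (I : finType) (p t : I -> 'rV[K]_3).

Implicit Types (F G H L C : {mpoly K[3]}) (s r : I -> K * K) (l : I -> nat).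

Local Notation act := (act p t).
Local Notation relation := (relation p t).
Local Notation vanishes_to := (vanishes_to p t).

(** The linear conditions of a profile: a value where l is positive, and a
    derivative, tagged true, where l is two. *)
Definition conds l : pred (I * bool) := [pred x : I * bool | (x.2 < l x.1)%N].

Definition cond (x : I * bool) F : K :=
  if x.2 then dder (t x.1) (p x.1) F else ev (p x.1) F.

Lemma cond_linear x : linear (cond x : {mpoly K[3]} -> K^o).
Proof.
by case: x => i [] a F G; rewrite /cond /= ?dder_linear ?ev_linear.
Qed.

Definition profile_cond l (x : {x in conds l}) := cond (val x).

Lemma profile_cond_linear l (x : {x in conds l}) :
  linear (profile_cond x : {mpoly K[3]} -> K^o).
Proof. exact: cond_linear. Qed.

Lemma card_conds l : (forall i, (l i <= 2)%N) ->
  #|{: {x in conds l}}| = (\sum_i l i)%N.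
Proof.
move=> l2; rewrite card_sig -sum1_card big_mkcond.
pose h i b : nat := if (i, b) \in conds l then 1 else 0.
rewrite (eq_bigr (fun x => h x.1 x.2)) => [|[]//].
rewrite -(pair_bigA _ h) /=.
apply: eq_bigr => i _; rewrite big_bool /h !inE /=.
by have := l2 i; case: (l i) => [|[|[]]].
Qed.

Lemma profile_cond_vanishes l F :
  (forall x : {x in conds l}, profile_cond x F = 0) <-> vanishes_to l F.
Proof.
split=> [F0 i|F0 [[i b] lib]]; last first.
  have [Fp Ft] := F0 i; have := lib; rewrite inE /profile_cond /cond /=.
  by case: b {lib}.
split=> li.
  by have := F0 (exist _ (i, false) li).
by have := F0 (exist _ (i, true) li).
Qed.

Lemma sum_conds l (g : I * bool -> K) :
  \sum_(x : {x in conds l}) g (val x) =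
  \sum_i ((if (0 < l i)%N then g (i, false) else 0) +
          (if (1 < l i)%N then g (i, true) else 0)).
Proof.
rewrite -(big_sub _ g) big_mkcond.
pose h i b := if (i, b) \in conds l then g (i, b) else 0.
rewrite (eq_bigr (fun x => h x.1 x.2)) => [|[]//].
rewrite -(pair_bigA _ h) /=.
by apply: eq_bigr => i _; rewrite big_bool /h !inE /= addrC.
Qed.

Lemma form_through l k : (forall i, (l i <= 2)%N) ->
    (\sum_i l i < 'C(k + 2, k))%N ->
  exists F, [/\ F \is k.-homog, F != 0 & vanishes_to l F].
Proof.
move=> l2; rewrite -card_conds //.
case/(form_common_zero (@profile_cond_linear l)) => F [hF F0 Fl].
by exists F; split=> //; apply/profile_cond_vanishes.
Qed.

Lemma form_through_mod l e d k E : (forall i, (l i <= 2)%N) ->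
    E \is e.-homog -> E != 0 -> (d + e)%N = k ->
    (\sum_i l i + 'C(d + 2, d) < 'C(k + 2, k))%N ->
  exists F, [/\ F \is k.-homog, vanishes_to l F &
                ~ exists2 A, A \is d.-homog & F = A * E].
Proof.
move=> l2 hE E0 dk; rewrite -card_conds //.
case/(form_common_zero_mod (@profile_cond_linear l) hE E0 dk) => F [hF Fl FE].
by exists F; split=> //; apply/profile_cond_vanishes.
Qed.

(** A rank computation decides whether a form of degree k contains a scheme; this
    is what allows arguing by contradiction below. *)
Lemma killing_form_dec k s :
  (exists F, [/\ F \is k.-homog, F != 0 & len (act F s) = 0%N]) \/
  (forall F, F \is k.-homog -> F != 0 -> (0 < len (act F s))%N).
Proof.
case: (form_common_zero_dec (@profile_cond_linear (fun i => local_len (s i))) k).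
  case=> F [hF F0 Fl]; left; exists F; split=> //.
  by apply: vanishes_killed; apply/profile_cond_vanishes.
move=> none; right=> F hF F0; rewrite lt0n; apply: contra_neqN F0 => /eqP Fs.
by apply: none hF _; apply/profile_cond_vanishes/killed_vanishes.
Qed.

Lemma relation_of_kernel l k (U : {vspace dhomog 3 K k}) :
    (forall i, (l i <= 2)%N) ->
    (forall F : dhomog 3 K k, F \in U -> vanishes_to l (val F)) ->
    ('C(k + 2, k) < \dim U + \sum_i l i)%N ->
  exists r, [/\ forall i, (local_len (r i) <= l i)%N, (0 < len r)%N &
                relation k r].
Proof.
move=> l2 Ul; rewrite -card_conds //.
case/(related_of_kernel (@profile_cond_linear l)) => [F FU|c [x0 cx0] crel].
  exact/profile_cond_vanishes/Ul.
pose c' y := if insub y is Some x then c x else 0.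
have c'E x : c' (val x) = c x by rewrite /c' valK.
have c'0 y : y \notin conds l -> c' y = 0.
  by rewrite /c'; case: insubP => // x -> .
exists (fun i => (c' (i, false), c' (i, true))); split=> [i||F hF].
- have := l2 i; have := c'0 (i, false); have := c'0 (i, true).
  rewrite /local_len !inE /=; case: (l i) => [|[|[|//]]] c1 c2 _.
  + by rewrite c1 // c2 // eqxx.
  + by rewrite c1 // eqxx /=; case: (_ == _).
  + by case: ifP => // _; case: (_ == _).
- apply/len_gt0P; move: cx0; rewrite -c'E; case: (val x0) => i b ci.
  exists i; rewrite local_len_eq0 xpair_eqE.
  by case: b ci => /negbTE ->; rewrite ?andbF.
have := crel F hF; rewrite /pairing /=.
under eq_bigr do rewrite -c'E.
rewrite (sum_conds l (fun y => c' y * cond y F)) => cF; rewrite -[RHS]cF.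
apply: eq_bigr => i _; rewrite /cond /=.
by congr (_ + _); case: ifP => // li; rewrite c'0 ?inE /= ?li // mul0r.
Qed.

(** A scheme carrying a relation fails to impose independent conditions, so it lies
    on a curve of degree k even if its length equals the number of coefficients. *)
Lemma relation_curve k r : relation k r -> (0 < len r)%N ->
    (len r <= 'C(k + 2, k))%N ->
  exists F, [/\ F \is k.-homog, F != 0 & len (act F r) = 0%N].
Proof.
move=> rrel /len_gt0P [i ri]; pose l i := local_len (r i).
have l2 j : (l j <= 2)%N by exact: local_len_le2.
rewrite -[len r](card_conds l2) => card_le.
pose c (x : {x in conds l}) :=
  if (val x).2 then (r (val x).1).2 else (r (val x).1).1.
have c0 : exists x, c x != 0.
  have [b0|b0] := eqVneq (r i).2 0.
    have li : (i, false) \in conds l by rewrite inE /= lt0n.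
    exists (Sub (i, false) li : {x in conds l}); rewrite /c /=.
    move: ri; rewrite /local_len b0 eqxx /=.
    by case: ((r i).1 != 0).
  have li : (i, true) \in conds l by rewrite inE /= /l /local_len b0.
  by exists (Sub (i, true) li : {x in conds l}).
have crel : related (@profile_cond l) k c.
  move=> F hF; rewrite -[RHS](rrel F hF).
  rewrite (sum_conds l (fun y => (if y.2 then (r y.1).2 else (r y.1).1) * cond y F)).
  apply: eq_bigr => j _; rewrite /cond /= /l /local_len.
  have [->|b0] := eqVneq (r j).2 0; rewrite ?mul0r //=.
  by have [->|a0] := eqVneq (r j).1 0; rewrite ?mul0r.
have [F [hF F0 Fl]] :=
  related_common_zero (@profile_cond_linear l) c0 crel card_le.
exists F; split=> //; apply: vanishes_killed.
by apply/profile_cond_vanishes.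
Qed.

End Schemes.

(** * Short weight relations live on lines and conics *)

(** Restriction to a line: 'C(k + 2, k) is the number of coefficients of a ternary
    form of degree k, and k + 2 that of a binary form of degree k + 1. *)
Lemma bin_formsS k : 'C(k.+1 + 2, k.+1) = ('C(k + 2, k) + k.+2)%N.
Proof. by rewrite addSn addn2 binS binSn addnC. Qed.

Section Curves.

Variables (K : fieldType) (I : finType) (p t : I -> 'rV[K]_3).
Hypotheses (p_neq0 : forall i, p i != 0)
  (p_inj : forall i j, i != j -> ~~ (p i <= p j)%MS)
  (t_indep : forall i, ~~ (t i <= p i)%MS).

Implicit Types (F G H L C : {mpoly K[3]}) (s r : I -> K * K) (l : I -> nat).

Local Notation act := (act p t).
Local Notation relation := (relation p t).
Local Notation vanishes_to := (vanishes_to p t).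
Local Notation short_relation := (short_relation p_neq0 p_inj t_indep).

Lemma profile_le2 l s : (forall i, (l i <= local_len (s i))%N) ->
  forall i, (l i <= 2)%N.
Proof. by move=> ls i; apply: leq_trans (ls i) (local_len_le2 _). Qed.

Lemma form_cutting u k s : (u < 'C(k + 2, k))%N -> (u <= len s)%N ->
  exists F, [/\ F \is k.-homog, F != 0 & (len (act F s) + u <= len s)%N].
Proof.
move=> lt_u /sub_profile [l ls lu].
have [|F [hF F0 Fl]] := form_through p t (profile_le2 ls) (k := k).
  by rewrite lu.
by exists F; split=> //; rewrite -lu; apply: len_vanishing.
Qed.

Lemma killing_form k s : (len s < 'C(k + 2, k))%N ->
  exists F, [/\ F \is k.-homog, F != 0 & len (act F s) = 0%N].
Proof.
move=> lt_s; have [F [hF F0 lenF]] := form_cutting lt_s (leqnn _).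
by exists F; split=> //; lia.
Qed.

(** Any line L cutting the scheme in length two leaves a residual with a relation
    of degree k - 1, which by induction lies on a line M, yet has length at least
    k + 1. So M contains so much of the scheme that the residual with respect to
    M is too short to carry a relation. *)
Lemma on_line k s : relation k s -> (len s <= k.*2.+1)%N ->
  exists L, [/\ L \is 1.-homog, L != 0 & len (act L s) = 0%N].
Proof.
elim: k s => [|k IH] s rs len_s.
  by apply: killing_form; rewrite (short_relation rs).
have [len2|len2] := leqP (len s) 2; first exact: killing_form.
have [L [hL L0 lenL]] := form_cutting (k := 1) (u := 2) isT (ltnW len2).
rewrite -addn1 in rs; have rL := relation_act hL rs.
have [|M [hM M0 lenM]] := IH _ rL; first by lia.
have [|lenL'] := leqP (len (act L s)) k.+1.
  by move/(short_relation rL) => L_s; exists L.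
exists M; split=> //; apply: short_relation (relation_act hM rs) _.
by rewrite len_act_act in lenM; have := len_residual lenM; lia.
Qed.

Definition on_conic_below d := forall k s, (k < d)%N ->
  relation k s -> (len s < 3 * k)%N ->
  exists C, [/\ C \is 2.-homog, C != 0 & len (act C s) = 0%N].

(** When a line L leaves a residual to which the induction applies, that residual
    lies on a conic C. If it is long, C contains so much of the scheme that it
    contains everything; if it is short, it lies on a line M, and M L is the
    required conic. *)
Lemma on_conic_line d s L : on_conic_below d.+1 -> relation d.+1 s ->
    (0 < d)%N -> (len s < 3 * d.+1)%N ->
    L \is 1.-homog -> L != 0 -> (len (act L s) < 3 * d)%N ->
  exists C, [/\ C \is 2.-homog, C != 0 & len (act C s) = 0%N].
Proof.
move=> IH rs d0 len_s hL L0 lenL; rewrite -addn1 in rs.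
have rL := relation_act hL rs.
have [small|big] := leqP (len (act L s)) d.*2.+1.
  have [M [hM M0 ML]] := on_line rL small.
  exists (M * L); split; rewrite ?mulf_neq0 -?len_act_act //.
  exact: dhomogM hM hL.
have [C [hC C0 CL]] := IH d _ (leqnn _) rL lenL.
exists C; split=> //; case: d {IH lenL} => // d in rs d0 len_s rL big *.
rewrite addSnnS in rs.
apply: short_relation (relation_act hC rs) _.
by rewrite len_act_act in CL; have := len_residual CL; lia.
Qed.

(** The extremal case: length 3 d - 1, every line meeting the scheme in length at
    most two, and no conic containing it. Residuation bounds what conics can
    contain, then makes all shorter subschemes impose independent conditions.
    Consequently the scheme lies on a cubic F and on a curve G of degree d - 2
    outside (F); their multiples leave too few forms of degree d - 1 for a
    subscheme of length 3 d - 4 to impose independent conditions. *)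
Section NoConic.

Variables (d : nat) (s : I -> K * K).
Hypotheses (IH : on_conic_below d) (rs : relation d s) (d3 : (3 <= d)%N)
  (len_s : (len s).+1 = (3 * d)%N)
  (lines : forall L, L \is 1.-homog -> L != 0 ->
     (len s <= len (act L s) + 2)%N)
  (no_conic : forall C, C \is 2.-homog -> C != 0 -> (0 < len (act C s))%N).

Let relation_residual k e F : F \is e.-homog -> (k + e)%N = d ->
  relation k (act F s).
Proof. by move=> hF kd; apply: relation_act hF _; rewrite kd. Qed.

(** A conic C meeting the scheme in length six or more leaves a residual which, by
    induction, lies on a conic C'. If that residual is short, it lies on a line, so
    it has length at most two, which is too short for its relation, and C contains
    the scheme. If it is long, the residual with respect to C' is short, and C'
    contains the scheme for the same reason. *)
Let conics C : C \is 2.-homog -> C != 0 -> (len s <= len (act C s) + 5)%N.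
Proof.
move=> hC C0; rewrite leqNgt; apply/negP=> lenC.
have dE : (d - 2 + 2)%N = d by lia.
have rC := relation_residual hC dE.
have [||C' [hC' C'0 C'C]] := IH _ rC; [lia|lia|].
rewrite len_act_act in C'C; have resC := len_residual C'C.
have [small|big] := leqP (len (act C s)) (d - 2).*2.+1.
  have [M [hM M0 MC]] := on_line rC small.
  rewrite len_act_act in MC; have := len_residual MC; have := lines hM M0.
  have := no_conic hC C0 => C_gt0 M2 resM.
  have : len (act C s) = 0%N by apply: short_relation rC _; lia.
  lia.
have rC' := relation_residual hC' dE.
have [|M [hM M0 MC']] := on_line rC'; first by lia.
rewrite len_act_act in MC'; have := len_residual MC'; have := lines hM M0.
have := no_conic hC' C'0 => C'_gt0 M2 resM.
have : len (act C' s) = 0%N by apply: short_relation rC' _; lia.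
lia.
Qed.

(** The scheme of a relation of degree k would lie on a conic, hence be of length
    at most five, hence lie on a line, hence be of length at most two. *)
Let independent k r : (0 < k < d)%N -> relation k r ->
  (forall i, (local_len (r i) <= local_len (s i))%N) -> (len r < 3 * k)%N ->
  len r = 0%N.
Proof.
case/andP=> k0 kd rr r_s len_r.
have [C [hC C0 Cr]] := IH kd rr len_r.
have := len_killed Cr r_s; have := conics hC C0 => C5 resC.
have [k1|k1] := leqP k 1; first by apply: short_relation rr _; lia.
have [|L [hL L0 Lr]] := on_line rr; first by lia.
have := len_killed Lr r_s; have := lines hL L0 => L2 resL.
by apply: short_relation rr _; lia.
Qed.

(** Six conditions on conics are independent here, since conics contain length at
    most five of the scheme. *)
Let conic_conditions r : relation 2 r ->
  (forall i, (local_len (r i) <= local_len (s i))%N) -> (len r <= 6)%N ->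
  len r = 0%N.
Proof.
move=> rr r_s len_r; apply/eqP; rewrite eqn0Ngt; apply/negP=> r0.
have [C [hC C0 Cr]] := relation_curve rr r0 len_r.
have := len_killed Cr r_s; have := conics hC C0 => C5 resC.
have : len r = 0%N by apply: (independent (k := 2)) => //; lia.
lia.
Qed.

Let killed_by_complement G : G \is (d - 2).-homog ->
  (len (act G s) <= 6)%N -> len (act G s) = 0%N.
Proof.
move=> hG; apply: conic_conditions => [|i]; last exact: local_len_act.
by apply: relation_residual hG _; lia.
Qed.

(** For d = 3 and d = 4 the curve G of degree d - 2 is a line or a conic, and it
    contains the whole scheme. *)
Let d_ge5 : (5 <= d)%N.
Proof.
rewrite leqNgt; apply/negP=> d5.
have [||G [hG G0 lenG]] := @form_cutting (3 * d - 7) (d - 2) s; last 1 first.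
- have G_s : len (act G s) = 0%N by apply: killed_by_complement => //; lia.
  have [d3'|d4] : (d = 3 \/ d = 4)%N by lia.
    rewrite d3' in hG; have := lines hG G0; lia.
  rewrite d4 in hG; have := no_conic hG G0; lia.
- have [->|->] : (d = 3 \/ d = 4)%N by lia.
    by [].
  by [].
- lia.
Qed.

Let cubic : exists F, [/\ F \is 3.-homog, F != 0 & len (act F s) = 0%N].
Proof.
have [||F [hF F0 lenF]] := @form_cutting 9 3 s => //; first by lia.
exists F; split=> //; apply: (independent (k := d - 3)); [lia| | |lia].
- by apply: relation_residual hF _; lia.
- by move=> i; exact: local_len_act.
Qed.

Lemma no_conic_absurd : False.
Proof.
have [F [hF F0 Fs]] := cubic.
have eE : (d - 5 + 3)%N = (d - 2)%N by lia.
have [|l ls lu] := @sub_profile _ (fun i => local_len (s i)) (3 * d - 7).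
  by rewrite -/(len s); lia.
have l2 := profile_le2 ls.
(* The forms of degree d - 2 modulo F have dimension 3 (d - 2), one more than
   the 3 d - 7 conditions imposed. *)
have [|G [hG Gl GF]] := form_through_mod p t l2 hF F0 eE.
  rewrite lu (_ : d - 2 = (d - 5).+3)%N; last by lia.
  by rewrite !bin_formsS; lia.
have {lu} Gs : len (act G s) = 0%N.
  apply: killed_by_complement => //.
  by have := len_vanishing Gl ls; rewrite lu; lia.
have dF : (d - 4 + 3)%N = (d - 1)%N by lia.
have dG : (1 + (d - 2))%N = (d - 1)%N by lia.
have G0 : G != 0.
  by apply/eqP => G0; apply: GF; exists 0; rewrite ?rpred0 // mul0r.
pose U := limg (mulform hF dF); pose V := limg (mulform hG dG).
(* A common multiple A F = L G makes L divide F, against the bounds for lines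
   and conics, or A, and then F divides G. *)
have UV : (U :&: V = 0)%VS.
  apply/eqP; rewrite -subv0; apply/subvP=> N.
  rewrite memv_cap => /andP[/mem_limg_mulform [A hA NA]].
  case/mem_limg_mulform => L hL NL; rewrite memv0; apply/negPn/negP => N0.
  have L0 : L != 0.
    by apply: contraNneq N0 => L0; apply/eqP/val_inj; rewrite /= NL L0 mul0r.
  have : A * F = L * G by rewrite -NA.
  case/(linear_form_prime hL L0) => [[B AB]|[C FC]].
    apply: GF; exists B; last first.
      by apply: (mulfI L0); rewrite -NL NA AB mulrA.
    apply: homog_quotient hL L0 _; rewrite -AB.
    by rewrite (_ : _ + _ = d - 4)%N //; lia.
  have hC : C \is 2.-homog by apply: homog_quotient hL L0 _; rewrite -FC.
  have C0 : C != 0 by apply: contraNneq F0 => C0; rewrite FC C0 mulr0.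
  move: Fs; rewrite FC => /len_residual.
  have := lines hL L0; have := conics hC C0; lia.
have [|l' l's l'u] := @sub_profile _ (fun i => local_len (s i)) (3 * d - 4).
  by rewrite -/(len s); lia.
have killed N : len (act N s) = 0%N -> vanishes_to l' N.
  move/killed_vanishes => Ns i; have [N0 N1] := Ns i; have := l's i => li.
  by split=> l'i; [apply: N0 | apply: N1]; apply: leq_trans li.
have mul_killed A N : len (act N s) = 0%N -> len (act (A * N) s) = 0%N.
  by move=> Ns; apply/eqP; rewrite -leqn0 -len_act_act -Ns len_act.
have [||r [rl r0 rr]] :=
    relation_of_kernel (p := p) (t := t) (U := (U + V)%VS) (profile_le2 l's).
- move=> N /memv_addP [N1 /mem_limg_mulform [A _ N1A]].
  case=> N2 /mem_limg_mulform [B _ N2B] ->.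
  have /killed A0 := mul_killed A _ Fs; have /killed B0 := mul_killed B _ Gs.
  move=> i; rewrite /= N1A N2B evD dderD.
  have [A1 A2] := A0 i; have [B1 B2] := B0 i.
  by split=> l'i; [rewrite A1 ?B1 ?addr0 | rewrite A2 ?B2 ?addr0].
- rewrite l'u dimv_disjoint_sum // !dim_limg_mulform //.
  rewrite (_ : d - 1 = (d - 4).+3)%N; last by lia.
  by rewrite !bin_formsS bin0; lia.
have len_r : (len r <= \sum_i l' i)%N by apply: leq_sum.
have : len r = 0%N.
  apply: (independent _ rr) => [|i|]; [lia| |lia].
  exact: leq_trans (rl i) (l's i).
lia.
Qed.

End NoConic.

(** A line through length two of the scheme exists, so the induction on d only
    leaves the extremal case. *)
Theorem on_conic d s : relation d s -> (len s < 3 * d)%N ->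
  exists C, [/\ C \is 2.-homog, C != 0 & len (act C s) = 0%N].
Proof.
elim/ltn_ind: d s => d IH0 s rs len_s.
have IH : on_conic_below d by move=> k r kd; apply: IH0.
have [len5|len5] := leqP (len s) 5; first by apply: killing_form.
have [//|no_conic] := killing_form_dec p t 2 s.
have [e dE] : exists e, d = e.+2.+1 by exists (d - 3)%N; lia.
have lines L : L \is 1.-homog -> L != 0 -> (3 * e.+2 <= len (act L s))%N.
  move=> hL L0; rewrite leqNgt; apply/negP=> lenL.
  rewrite dE in IH rs len_s.
  have [C [hC C0 Cs]] := on_conic_line IH rs isT len_s hL L0 lenL.
  by have := no_conic C hC C0; rewrite Cs.
have [||L [hL L0 lenL]] := @form_cutting 2 1 s => //; first by lia.
have linesL := lines L hL L0.
exfalso; apply: (no_conic_absurd IH rs _ _ _ no_conic); [lia|lia|].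
by move=> M hM M0; have := lines M hM M0; lia.
Qed.

End Curves.

(** * Jet relations on sets of points *)

Section Points.

Variables (K : fieldType) (n : nat).
Implicit Types (P Q : projpt K n) (A B S : {fset projpt K n}).

Definition rep P : 'rV[K]_n.+1 := vpick (val P).

Lemma rep_neq0 P : rep P != 0.
Proof. by rewrite /rep vpick0 -dimv_eq0 (eqP (valP P)). Qed.

Lemma val_rep P : val P = <[rep P]>%VS.
Proof.
apply/eqP; rewrite eq_sym eqEdim -memvE memv_pick /=.
by rewrite (eqP (valP P)) dim_vline rep_neq0.
Qed.

Lemma mem_rep P : rep P \in val P. Proof. exact: memv_pick. Qed.

Lemma on_subspace_rep (W : {vspace 'rV[K]_n.+1}) P :
  on_subspace W P = (rep P \in W).
Proof. by rewrite /on_subspace val_rep memvE. Qed.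

Lemma rep_inj P Q : P != Q -> ~~ (rep P <= rep Q)%MS.
Proof.
apply: contraNN => /sub_rVP [c PQ]; apply/eqP/val_inj/eqP.
rewrite eqEdim (eqP (valP P)) (eqP (valP Q)) leqnn andbT.
by rewrite val_rep -memvE PQ memvZ // mem_rep.
Qed.

Lemma vanishes_rep d (F : {mpoly K[n.+1]}) P : F \is d.-homog ->
  vanishes_at F P <-> ev (rep P) F = 0.
Proof.
move=> hF; split=> [F0|F0 v]; first exact/F0/mem_rep.
by rewrite val_rep => /vlineP [c ->]; rewrite -/(ev _ _) (ev_scale _ _ hF) F0 mulr0.
Qed.

(** The scheme 2A imposes dependent conditions on forms of degree d when the
    partial derivatives at the points of A satisfy a nonzero linear relation; by
    Euler's formula, values are combinations of derivatives. *)
Definition jet_relation d A (w : projpt K n -> 'rV[K]_n.+1) :=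
  forall F, F \is d.-homog -> \sum_(P <- A) dder (w P) (rep P) F = 0.

Definition dependent d A :=
  exists2 w, exists2 P, P \in A & w P != 0 & jet_relation d A w.

Definition full_dependent d A :=
  exists2 w, forall P, P \in A -> w P != 0 & jet_relation d A w.

Lemma dependent_full d A : dependent d A ->
  exists B, [/\ (B `<=` A)%fset, B != fset0 & full_dependent d B].
Proof.
case=> w [P PA wP] rel; exists [fset Q in A | w Q != 0]%fset; split.
- by apply/fsubsetP=> Q; rewrite !inE => /andP[].
- by apply/fset0Pn; exists P; rewrite !inE /= PA.
exists w => [Q|F hF]; first by rewrite !inE => /andP[].
rewrite -[RHS](rel F hF) [RHS](big_fsetID _ (fun Q => w Q != 0)) /=.
rewrite [X in _ + X]big_seq [X in _ + X]big1 ?addr0 // => Q.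
by rewrite !inE => /andP[_ /negPn/eqP ->]; rewrite dder_dir0.
Qed.

Lemma full_dependent_sub d A B : full_dependent d B -> B != fset0 ->
  (B `<=` A)%fset -> dependent d A.
Proof.
case=> w w0 rel /fset0Pn [P PB] /fsubsetP BA.
exists (fun Q => if Q \in B then w Q else 0) => [|F hF].
  by exists P; [exact: BA | rewrite PB w0].
rewrite -[RHS](rel F hF) (big_fsetID _ (fun Q => Q \in B)) /=.
rewrite [X in _ + X]big_seq [X in _ + X]big1 ?addr0 => [|Q]; last first.
  by rewrite !inE => /andP[_ /negbTE ->]; rewrite dder_dir0.
rewrite (_ : [fset Q in A | Q \in B]%fset = B); last first.
  by apply/fsetP=> Q; rewrite !inE /= andb_idl // => /BA.
by apply: eq_big_seq => Q ->.
Qed.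

End Points.

Section Plane.

Variables (K : fieldType).
Hypothesis charK : [pchar K] =i pred0.

Implicit Types (P Q : projpt K 2) (A B S : {fset projpt K 2}).
Implicit Types (F G H L C E : {mpoly K[3]}).

Lemma natr_neq0 d : (0 < d)%N -> d%:R != 0 :> K.
Proof. by rewrite (pcharf0P K).1 // lt0n. Qed.

(** The directions along which F has derivative zero at v form a space of dimension
    at least two, so not all of them are along v. *)
Lemma tangent_direction F (v : 'rV[K]_3) :
  exists2 u : 'rV[K]_3, dder u v F = 0 & ~~ (u <= v)%MS.
Proof.
pose c : 'cV[K]_3 := \col_k ev v F^`M(k).
have dderE u : dder u v F = (u *m c) 0 0.
  by rewrite mxE; apply: eq_bigr => k _; rewrite mxE.
have : ~~ (kermx c <= v)%MS.
  apply/negP => /mxrankS; rewrite mxrank_ker.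
  by have := rank_leq_col c; have := rank_leq_row v; lia.
case/row_subPn=> i ci; exists (row i (kermx c)) => //.
by rewrite dderE -row_mul mulmx_ker row0 mxE.
Qed.

Section OnSet.

Variable A : {fset projpt K 2}.

Let p (i : A) : 'rV[K]_3 := rep (val i).

Let p_neq0 i : p i != 0. Proof. exact: rep_neq0. Qed.

Let p_inj (i j : A) : i != j -> ~~ (p i <= p j)%MS.
Proof. exact: rep_inj. Qed.

(** The relation only involves one tangent vector at each point, so it lives on a
    subscheme of 2A that is of length at most two at each point. This is where
    2A, of length 3 #A, gets replaced by a scheme of length at most 2 #A. A vector along
    the point itself gives the value there, with the nonzero factor d. *)
Lemma relation_of_jets d w : (0 < d)%N ->
    (forall P, P \in A -> w P != 0) -> jet_relation d A w ->
  exists t r, [/\ forall i, ~~ (t i <= p i)%MS, relation p t d r &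
                  forall i, local_len (r i) != 0%N].
Proof.
move=> d0 w0 rel.
have local (i : A) : exists tx : 'rV[K]_3 * (K * K),
    [/\ ~~ (tx.1 <= p i)%MS, local_len tx.2 != 0%N & forall F,
      F \is d.-homog -> tx.2.1 * ev (p i) F + tx.2.2 * dder tx.1 (p i) F =
        dder (w (val i)) (p i) F].
  have [/sub_rVP [c wc]|wp] := boolP (w (val i) <= p i)%MS; last first.
    exists (w (val i), (0, 1)); split=> //= [|F _].
      by rewrite /local_len oner_neq0.
    by rewrite mul0r add0r mul1r.
  have [u _ up] := tangent_direction 0 (p i).
  exists (u, (c * d%:R, 0)); split=> //= [|F hF]; last first.
    by rewrite mul0r addr0 wc dder_dirZ (euler _ hF) mulrA.
  rewrite /local_len eqxx /= mulf_neq0 ?natr_neq0 //.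
  by apply: contraNneq (w0 _ (valP i)) => c0; rewrite wc c0 scale0r.
have [tx txP] := fin_all_exists local.
exists (fun i => (tx i).1), (fun i => (tx i).2); split=> [i|F hF|i].
- by case: (txP i).
- rewrite -[RHS](rel F hF) big_seq_fsetE; apply: eq_bigr => i _.
  by case: (txP i) => _ _ /(_ F hF).
- by case: (txP i).
Qed.

Lemma jets_of_relation d t r : (0 < d)%N ->
    (forall i, ~~ (t i <= p i)%MS) -> relation p t d r -> (0 < len r)%N ->
  dependent d A.
Proof.
move=> d0 tp rel /len_gt0P [i0 ri0].
pose v i := ((r i).1 / d%:R) *: p i + (r i).2 *: t i.
pose w P := if insub P is Some i then v i else 0.
have wE i : w (val i) = v i by rewrite /w valK.
exists w => [|F hF].
  exists (val i0); first exact: valP.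
  rewrite wE; apply: contraNneq ri0; rewrite /v /local_len.
  have [->|b0] := eqVneq (r i0).2 0.
    rewrite scale0r addr0 => /eqP; rewrite scaler_eq0 (negbTE (p_neq0 _)) orbF.
    by rewrite mulf_eq0 invr_eq0 (negbTE (natr_neq0 d0)) orbF => /eqP ->; rewrite eqxx.
  move=> /eqP; rewrite addrC addr_eq0 => /eqP bt.
  case/negP: (tp i0); apply/sub_rVP.
  exists ((r i0).2^-1 * - ((r i0).1 / d%:R)).
  by rewrite -scalerA scaleNr -bt scalerA mulVf // scale1r.
rewrite big_seq_fsetE -[RHS](rel F hF); apply: eq_bigr => i _.
rewrite wE /v dder_dirD !dder_dirZ (euler _ hF) /=.
by rewrite mulrA divfK ?natr_neq0.
Qed.

Lemma len_le_card (r : A -> K * K) : (len r <= #|` A|.*2)%N.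
Proof.
rewrite cardfE -muln2 -sum_nat_const; apply: leq_sum => i _.
exact: local_len_le2.
Qed.

Lemma len_gt0 (r : A -> K * K) : (forall i, local_len (r i) != 0%N) ->
  A != fset0 -> (0 < len r)%N.
Proof.
by move=> r0 /fset0Pn [P PA]; apply/len_gt0P; exists [` PA]%fset; apply: r0.
Qed.

Lemma killing_form_contains t (r : A -> K * K) H : (forall i, local_len (r i) != 0%N) ->
  len (act p t H r) = 0%N -> forall P, P \in A -> ev (rep P) H = 0.
Proof.
move=> r0 /killed_vanishes Hr P PA; have [Hp _] := Hr [` PA]%fset.
by apply: Hp; rewrite lt0n.
Qed.

(** The three bounds below are those for weight relations, read on the points. *)
Lemma full_dependent_card d : (0 < d)%N -> full_dependent d A ->
  A != fset0 -> (d.+2 <= #|` A|.*2)%N.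
Proof.
move=> d0 [w w0 rel] A0.
have [t [r [tp rr r0]]] := relation_of_jets d0 w0 rel.
rewrite ltnNge; apply/negP=> smallA.
have : len r = 0%N.
  apply: short_relation rr _ => //.
  exact: leq_trans (len_le_card r) smallA.
by have := len_gt0 r0 A0; lia.
Qed.

Lemma full_dependent_line d : (0 < d)%N -> full_dependent d A ->
    (#|` A| <= d)%N ->
  exists L, [/\ L \is 1.-homog, L != 0 &
                forall P, P \in A -> ev (rep P) L = 0].
Proof.
move=> d0 [w w0 rel] smallA.
have [t [r [tp rr r0]]] := relation_of_jets d0 w0 rel.
have [|L [hL L0 Lr]] := on_line p_neq0 p_inj tp rr.
  by have := len_le_card r; lia.
by exists L; split=> //; apply: killing_form_contains Lr.
Qed.

Lemma full_dependent_conic d : (0 < d)%N -> full_dependent d A ->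
    (2 * #|` A| < 3 * d)%N ->
  exists C, [/\ C \is 2.-homog, C != 0 &
                forall P, P \in A -> ev (rep P) C = 0].
Proof.
move=> d0 [w w0 rel] smallA.
have [t [r [tp rr r0]]] := relation_of_jets d0 w0 rel.
have [|C [hC C0 Cr]] := on_conic p_neq0 p_inj tp rr.
  by have := len_le_card r; lia.
by exists C; split=> //; apply: killing_form_contains Cr.
Qed.

(** The value and the derivative along E at a point of A kill the multiples of E;
    together these 2 #A functionals are too many for the forms of degree k + e
    modulo E. The curve may be singular at points of A. *)
Lemma curve_dependent e k E : E \is e.-homog -> E != 0 -> (0 < k + e)%N ->
    (forall P, P \in A -> ev (rep P) E = 0) ->
    ('C(k + e + 2, k + e) < 'C(k + 2, k) + #|` A|.*2)%N ->
  dependent (k + e) A.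
Proof.
move=> hE E0 ke0 AE dims.
have [t tP] := fin_all_exists2 (fun i : A => tangent_direction E (p i)).
move=> tp; have [//|N||r [_ r0 rr]] := @relation_of_kernel _ _ p t (fun=> 2%N) (k + e)%N
    (limg (mulform hE erefl)).
- case/mem_limg_mulform=> B _ NB i; have Ei := AE _ (valP i).
  by rewrite NB evM dderM tP [ev (p i) E]Ei !mulr0 add0r.
- by rewrite dim_limg_mulform // sum_nat_const -cardfE muln2.
exact: jets_of_relation rr r0.
Qed.

End OnSet.

End Plane.

(** * The square of the ideal of a set of points *)

Section IdealProduct.

Variables (A : comNzRingType) (I J : A -> Prop).

Lemma ideal_mul_base a b : I a -> J b -> ideal_mul I J (a * b).
Proof.
move=> Ia Jb; exists 1%N, (fun=> a), (fun=> b); split=> //.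
by rewrite big_ord1.
Qed.

Lemma ideal_mul0 : ideal_mul I J 0.
Proof.
by exists 0%N, (fun=> 0), (fun=> 0); split=> [[]|[]|]//; rewrite big_ord0.
Qed.

Lemma ideal_mulD a b : ideal_mul I J a -> ideal_mul I J b ->
  ideal_mul I J (a + b).
Proof.
case=> m [g [h [Ig Jh ->]]] [m' [g' [h' [Ig' Jh' ->]]]].
pose glue (u : 'I_m -> A) (u' : 'I_m' -> A) i :=
  match split i with inl j => u j | inr j => u' j end.
exists (m + m')%N, (glue g g'), (glue h h').
split=> [i|i|]; rewrite /glue; try by case: split.
rewrite big_split_ord /=; congr (_ + _); apply: eq_bigr => i _.
  by rewrite (unsplitK (inl i : 'I_m + 'I_m')).
by rewrite (unsplitK (inr i : 'I_m + 'I_m')).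
Qed.

Lemma ideal_mul_sum (T : Type) (s : seq T) (P : pred T) (f : T -> A) :
  (forall i, P i -> ideal_mul I J (f i)) ->
  ideal_mul I J (\sum_(i <- s | P i) f i).
Proof. by move=> fP; apply: big_ind => //; [exact: ideal_mul0|exact: ideal_mulD]. Qed.

Lemma ideal_mulMl a b : (forall c d, I d -> I (c * d)) ->
  ideal_mul I J b -> ideal_mul I J (a * b).
Proof.
move=> IM [m [g [h [Ig Jh ->]]]]; exists m, (fun i => a * g i), h.
by split=> // [i|]; [exact: IM | rewrite mulr_sumr; under eq_bigr do rewrite mulrA].
Qed.

End IdealProduct.

Section DoubleZero.

Variables (K : fieldType) (n : nat).
Implicit Types (F G H M : {mpoly K[n.+1]}) (v : 'rV[K]_n.+1).
Implicit Types (P : projpt K n) (S : {fset projpt K n}).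

Definition double_zero v F := forall k, ev v F = 0 /\ ev v F^`M(k) = 0.

Lemma double_zero_ev v F : double_zero v F -> ev v F = 0.
Proof. by move=> /(_ 0)[]. Qed.

Lemma double_zero_dder w v F : double_zero v F -> dder w v F = 0.
Proof.
by move=> F0; rewrite /dder big1 // => k _; case: (F0 k) => _ ->; rewrite mulr0.
Qed.

Lemma double_zero0 v : double_zero v 0.
Proof. by move=> k; rewrite mderiv0 ev0. Qed.

Lemma double_zeroD v F G :
  double_zero v F -> double_zero v G -> double_zero v (F + G).
Proof.
move=> F0 G0 k; rewrite mderivD !evD.
by case: (F0 k) => -> ->; case: (G0 k) => -> ->; rewrite addr0.
Qed.

Lemma double_zeroM v F G : double_zero v F -> double_zero v (G * F).
Proof.
move=> F0 k; rewrite mderivM evD !evM.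
by case: (F0 k) => -> ->; rewrite !mulr0 addr0.
Qed.

Lemma double_zeroN v F : double_zero v F -> double_zero v (- F).
Proof. by rewrite -mulN1r; apply: double_zeroM. Qed.

Lemma double_zeroB v F G :
  double_zero v F -> double_zero v G -> double_zero v (F - G).
Proof. by move=> F0 /double_zeroN; apply: double_zeroD. Qed.

Lemma double_zero_mul v F G : ev v F = 0 -> ev v G = 0 -> double_zero v (F * G).
Proof.
by move=> F0 G0 k; rewrite mderivM evD !evM F0 G0 !mulr0 mul0r addr0.
Qed.

Lemma double_zero_cancel v F G :
  ev v F != 0 -> double_zero v (F * G) -> double_zero v G.
Proof.
move=> F0 FG k; have [/eqP] := FG k; rewrite mderivM evD !evM.
rewrite mulf_eq0 (negbTE F0) => /eqP -> /eqP.
by rewrite mulr0 add0r mulf_eq0 (negbTE F0) => /eqP ->.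
Qed.

(** One inclusion between the square of the ideal and the forms singular at the
    points; it holds without homogeneity. *)
Lemma double_ideal_double_zero S F P :
  double_ideal S F -> P \in S -> double_zero (rep P) F.
Proof.
case=> m [g [h [gS hS ->]]] PS; apply: big_ind => [||i _].
- exact: double_zero0.
- exact: double_zeroD.
apply: double_zero_mul; first exact: gS PS _ (mem_rep P).
exact: hS PS _ (mem_rep P).
Qed.

Lemma vanishing_idealM S F G : vanishing_ideal S G -> vanishing_ideal S (F * G).
Proof.
by move=> GS P PS v vP; rewrite mevalM (GS P PS v vP) mulr0.
Qed.

Lemma dhomog_mderiv d F k : F \is d.-homog -> F^`M(k) \is d.-1.-homog.
Proof.
move/dhomogP=> hF; rewrite [F]mpolyE raddf_sum /=.
rewrite big_seq rpred_sum // => m /hF md; rewrite mderivZ rpredZ // mderivX.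
have {}md : mdeg m = d := md.
have [->|mk] := posnP (m k); first by rewrite scale0r rpred0.
rewrite rpredZ // dhomogX /= -md -[in X in _ == X](@submK _ U_(k) m).
  by rewrite mdegD mdeg1 addn1.
by rewrite lep1mP -lt0n.
Qed.

Lemma comp_line v i d F : F \is d.-homog ->
  F \mPo [tuple v 0 j *: 'X_i | j < n.+1] = ev v F *: 'X_i ^+ d :> {mpoly K[n.+1]}.
Proof.
move/dhomogP=> hF; rewrite [F]mpolyE raddf_sum /= ev_sum scaler_suml.
apply: eq_big_seq => m /hF md; have {}md : mdeg m = d := md.
rewrite linearZ /= comp_mpolyX evZ -scalerA; congr (_ *: _).
rewrite /ev mevalX -md mdegE -prodrXr.
rewrite -scaler_prod; apply: eq_bigr => j _.
by rewrite tnth_mktuple exprZn.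
Qed.

Lemma comp_scale c d F : F \is d.-homog ->
  F \mPo [tuple c *: 'X_j | j < n.+1] = c ^+ d *: F.
Proof.
move/dhomogP=> hF; rewrite [F]mpolyE raddf_sum /= scaler_sumr.
apply: eq_big_seq => m /hF md; have {}md : mdeg m = d := md.
rewrite linearZ /= comp_mpolyX scalerA mulrC -scalerA; congr (_ *: _).
rewrite [in RHS]mpolyXE_id -md mdegE -prodrXr.
rewrite -scaler_prod; apply: eq_bigr => j _.
by rewrite tnth_mktuple exprZn.
Qed.

Section Taylor.

Variables (I : {mpoly K[n.+1]} -> Prop).
Hypotheses (I0 : I 0) (ID : forall a b, I a -> I b -> I (a + b))
  (IM : forall a b, I b -> I (a * b)).

(** Taylor expansion at u with increments in the ideal I, modulo I^2. *)
Lemma taylor_mod_square (u h : n.+1.-tuple {mpoly K[n.+1]}) F :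
    (forall j, I (tnth h j)) ->
  exists2 r, ideal_mul I I r &
    F \mPo [tuple tnth u j + tnth h j | j < n.+1] =
    F \mPo u + \sum_j (F^`M(j) \mPo u) * tnth h j + r.
Proof.
move=> Ih.
have I1 G : I (\sum_j (G^`M(j) \mPo u) * tnth h j).
  by apply: big_ind => // j _; apply: IM.
elim/mpoly_ring_ind: F => [c|i|F G [rF IF eF] [rG IG eG]|F G [rF IF eF] [rG IG eG]].
- exists 0; first exact: ideal_mul0.
  rewrite !comp_mpolyC big1 ?addr0 // => j _.
  by rewrite mderivC comp_mpoly0 mul0r.
- exists 0; first exact: ideal_mul0.
  rewrite !comp_mpolyXU -!tnth_nth tnth_mktuple addr0; congr (_ + _).
  rewrite (bigD1 i) //= big1 => [|j ji]; last first.
    by rewrite mderivX mnmE eq_sym (negbTE ji) scale0r comp_mpoly0 mul0r.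
  rewrite mderivX mnmE eqxx scale1r addr0.
  rewrite [(_ - _)%MM](_ : _ = 0%MM) ?mpolyX0 ?comp_mpoly1 ?mul1r //.
  by apply/mnmP=> k; rewrite mnmBE subnn mnm0E.
- exists (rF + rG); first exact: ideal_mulD.
  rewrite !comp_mpolyD eF eG.
  have -> : \sum_j ((F + G)^`M(j) \mPo u) * tnth h j =
     \sum_j (F^`M(j) \mPo u) * tnth h j + \sum_j (G^`M(j) \mPo u) * tnth h j.
    rewrite -big_split; apply: eq_bigr => j _.
    by rewrite mderivD comp_mpolyD mulrDl.
  by ring.
set dF := \sum_j _ in eF; set dG := \sum_j _ in eG.
exists (dF * dG + (G \mPo u + dG) * rF + (F \mPo u + dF + rF) * rG).
  apply: ideal_mulD; first apply: ideal_mulD.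
  - exact: ideal_mul_base (I1 F) (I1 G).
  - exact: ideal_mulMl IM IF.
  - exact: ideal_mulMl IM IG.
rewrite !rmorphM /= eF eG.
have -> : \sum_j ((F * G)^`M(j) \mPo u) * tnth h j =
    (G \mPo u) * dF + (F \mPo u) * dG.
  rewrite /dF /dG !mulr_sumr -big_split; apply: eq_bigr => j _.
  by rewrite mderivM comp_mpolyD !rmorphM /=; ring.
by ring.
Qed.

End Taylor.

(** With v a vector of P and v i nonzero, v i X_j = v j X_i + h j, where h j vanishes
    at P. Expanding F there, the terms of order zero and one are the value and the
    derivatives of F at v, and F is in the square of the ideal of P. *)
Lemma double_zero_square d F P : F \is d.-homog -> double_zero (rep P) F ->
  ideal_mul (fun G => vanishes_at G P) (fun G => vanishes_at G P) F.
Proof.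
move=> hF F0; set I := fun G => vanishes_at G P; set v := rep P in F0 *.
have [i vi] : exists i, v 0 i != 0 by apply/rV0Pn; exact: rep_neq0.
pose u := [tuple v 0 j *: 'X_i | j < n.+1] : n.+1.-tuple {mpoly K[n.+1]}.
pose h := [tuple v 0 i *: 'X_j - v 0 j *: 'X_i | j < n.+1]
  : n.+1.-tuple {mpoly K[n.+1]}.
have IM a b : I b -> I (a * b).
  by move=> Ib w wP; rewrite mevalM (Ib w wP) mulr0.
have Ih j : I (tnth h j).
  rewrite tnth_mktuple; move=> w; rewrite val_rep => /vlineP [c ->].
  rewrite -/(ev _ _) evB !evZ !evXi !mxE.
  by rewrite mulrCA [X in _ - X]mulrCA [v 0 i * _]mulrC subrr.
have [||r Ir] := @taylor_mod_square I _ _ IM u h F Ih.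
- by move=> w _; exact: meval0.
- by move=> a b Ia Ib w wP; rewrite mevalD Ia // Ib // addr0.
have -> : F \mPo [tuple tnth u j + tnth h j | j < n.+1] = v 0 i ^+ d *: F.
  rewrite -(comp_scale (v 0 i) hF); congr (F \mPo _).
  by apply: eq_from_tnth => j; rewrite !tnth_mktuple addrC subrK.
rewrite (comp_line _ _ hF) (double_zero_ev F0) scale0r add0r big1 ?add0r.
  move=> Fr; have -> : F = ((v 0 i ^+ d)^-1)%:MP * r.
    by rewrite -Fr mul_mpolyC scalerA mulVf ?scale1r // expf_neq0.
  exact: ideal_mulMl.
move=> j _; rewrite (comp_line _ _ (dhomog_mderiv j hF)).
by case: (F0 j) => _ ->; rewrite scale0r mul0r.
Qed.

Lemma separator_seq P (s : seq (projpt K n)) : exists Q : {mpoly K[n.+1]},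
  [/\ Q \is (size s).-homog, ev (rep P) Q != 0 &
      forall P', P' \in s -> P' != P -> ev (rep P') Q = 0].
Proof.
elim: s => [|P' s [Q [hQ QP Qs]]].
  by exists 1; split=> //; [exact: dhomog1 | rewrite /ev meval1 oner_neq0].
have [L [hL LP LP']] : exists L : {mpoly K[n.+1]},
    [/\ L \is 1.-homog, ev (rep P) L != 0 & P' != P -> ev (rep P') L = 0].
  have [->|ne] := eqVneq P' P.
    have [L hL LP] := nonvanishing_linform (rep_neq0 P).
    by exists L; split=> //; rewrite eqxx.
  rewrite eq_sym in ne; have [L [hL L0 LP]] := separating_linform (rep_inj ne).
  by exists L.
exists (L * Q); split=> [||P''].
- exact: dhomogM hL hQ.
- by rewrite evM mulf_neq0.
rewrite inE => /orP[/eqP -> /LP' LP0|P's ne].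
  by rewrite evM LP0 mul0r.
by rewrite evM (Qs P'') ?mulr0.
Qed.

(** A form that is a delta function on S, as a product of lines. *)
Lemma separator P S e : (#|` S| <= e)%N -> exists Q : {mpoly K[n.+1]},
  [/\ Q \is e.-homog, ev (rep P) Q = 1 &
      forall P', P' \in S -> P' != P -> ev (rep P') Q = 0].
Proof.
move=> Se; have [Q [hQ QP QS]] := separator_seq P (enum_fset S).
have [L hL LP] := nonvanishing_linform (rep_neq0 P).
pose R := L ^+ (e - #|` S|) * Q.
have RP : ev (rep P) R != 0 by rewrite evM evX mulf_neq0 ?expf_neq0.
exists ((ev (rep P) R)^-1 *: R); split=> [||P' P'S ne].
- rewrite rpredZ // -[in X in _ \is X.-homog](subnK Se); apply: dhomogM hQ.
  by have := dhomogMn (e - #|` S|) hL; rewrite mul1n.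
- by rewrite evZ mulVf.
by rewrite evZ [ev (rep P') R]evM (QS P' P'S ne) !mulr0.
Qed.

Lemma vanishing_ideal_homog d S F : F \is d.-homog ->
  (forall P, P \in S -> ev (rep P) F = 0) -> vanishing_ideal S F.
Proof. by move=> hF F0 P PS; apply/(vanishes_rep P hF)/F0. Qed.

(** Away from M = 0, the square of the ideal of S contains the forms singular at the
    points of S. With N the cardinal of S, write M^N = R + T, where T is a
    combination of separators Q P and R vanishes on S, and expand M^(2 N) M F:
    M F, R and Q P Q P' for distinct P and P' vanish on S, and (Q P)^2 F is in the
    square since F is in the square of the ideal of P. *)
Lemma double_ideal_saturation d q M F S : (0 < q)%N -> M \is q.-homog ->
    F \is d.-homog ->
    (forall P, P \in S -> ev (rep P) M != 0 -> double_zero (rep P) F) ->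
  exists N, double_ideal S (M ^+ N * F).
Proof.
move=> q0 hM hF F0; pose N := #|` S|; exists (2 * N).+1.
have [Q QP] := fin_all_exists (fun P : S => separator (val P) (leq_pmull N q0)).
have hMN : M ^+ N \is (q * N).-homog by exact: dhomogMn.
pose c (P : S) := ev (rep (val P)) M ^+ N.
pose T := \sum_P c P *: Q P; pose R := M ^+ N - T.
have hT : T \is (q * N).-homog.
  by apply: rpred_sum => P _; rewrite rpredZ //; case: (QP P).
have RS : vanishing_ideal S R.
  apply: (vanishing_ideal_homog (d := q * N)); first by rewrite rpredB.
  move=> P PS; pose P' : S := [` PS]%fset.
  rewrite evB evX ev_sum (bigD1 P') //= big1 => [|P'' ne].
    by rewrite evZ; case: (QP P') => _ -> _; rewrite mulr1 addr0 subrr.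
  rewrite evZ; case: (QP P'') => _ _ -> //; rewrite ?mulr0 //.
  by rewrite eq_sym -(inj_eq val_inj) in ne.
have FS : vanishing_ideal S (M * F).
  apply: (vanishing_ideal_homog (d := q + d)); first exact: dhomogM.
  move=> P PS; rewrite evM; have [->|MP] := eqVneq (ev (rep P) M) 0.
    by rewrite mul0r.
  by rewrite (double_zero_ev (F0 P PS MP)) mulr0.
have SM c1 c2 : vanishing_ideal S c2 -> vanishing_ideal S (c1 * c2).
  exact: vanishing_idealM.
have -> : M ^+ (2 * N).+1 * F =
    (R + 2%:R * T) * (R * (M * F)) +
    \sum_P \sum_P' (c P * c P') *: (Q P * Q P' * (M * F)).
  have -> : \sum_P \sum_P' (c P * c P') *: (Q P * Q P' * (M * F)) =
      T * T * (M * F).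
    rewrite {1 2}/T !mulr_suml; apply: eq_bigr => P _.
    rewrite mulr_sumr mulr_suml; apply: eq_bigr => P' _.
    by rewrite -!scalerAl -scalerAr -scalerAl scalerA.
  by rewrite mulnC exprS exprM -[M ^+ N](subrK T) -/R; ring.
apply: ideal_mulD; first by apply: ideal_mulMl => //; exact: ideal_mul_base.
apply: ideal_mul_sum => P _; apply: ideal_mul_sum => P' _.
rewrite -mul_mpolyC; have [<-|ne] := eqVneq P P'; last first.
  apply: ideal_mulMl => //; apply: ideal_mul_base => //.
  case: (QP P) (QP P') => hQ _ QP1 [hQ' _ QP2].
  apply: (vanishing_ideal_homog (d := q * N + q * N)); first exact: dhomogM.
  move=> P'' P''S; rewrite evM; have [PP''|] := eqVneq P'' (val P).
    rewrite [ev _ (Q P')]QP2 ?mulr0 // PP''.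
    by rewrite (inj_eq val_inj).
  by move=> ?; rewrite QP1 ?mul0r.
rewrite /c; have [->|MP] := eqVneq (ev (rep (val P)) M) 0.
  have N0 : (0 < N)%N.
    by rewrite cardfs_gt0; apply/fset0Pn; exists (val P); exact: valP.
  by rewrite expr0n eqn0Ngt N0 mul0r mpolyC0 mul0r; exact: ideal_mul0.
apply: ideal_mulMl => //.
have -> : Q P * Q P * (M * F) = M * (Q P * Q P * F) by ring.
apply: ideal_mulMl => //.
have [m [g [h [gP hP ->]]]] := double_zero_square hF (F0 _ (valP P) MP).
rewrite mulr_sumr; apply: ideal_mul_sum => i _.
have mulQ g1 : vanishes_at g1 (val P) -> vanishing_ideal S (Q P * g1).
  move=> g1P P'' P''S v vP''; rewrite mevalM.
  have [PP''|ne] := eqVneq P'' (val P); first by rewrite g1P -?PP'' // mulr0.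
  case: (QP P) => hQ _ /(_ P'' P''S ne) /(vanishes_rep P'' hQ) Q0.
  by rewrite (Q0 v vP'') mul0r.
by rewrite mulrACA; apply: ideal_mul_base; apply: mulQ.
Qed.

End DoubleZero.

(** * Cech cochains of the sheaf of the square *)

Lemma frac_scale (F : fieldType) (x a b : F) : a != 0 -> b != 0 ->
  x / a = b * x / (a * b).
Proof. by move=> a0 b0; field; rewrite a0 b0. Qed.

Section Sections.

Variables (K : fieldType) (n : nat).
Implicit Types (F G H M : {mpoly K[n.+1]}) (S : {fset projpt K n}).

Lemma dhomog_Xi i : ('X_i : {mpoly K[n.+1]}) \is 1.-homog.
Proof. by rewrite dhomogX /= mdeg1. Qed.

Lemma dhomog_Xin i m : ('X_i ^+ m : {mpoly K[n.+1]}) \is m.-homog.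
Proof. by have := dhomogMn m (dhomog_Xi i); rewrite mul1n. Qed.

Lemma mpolyX_neq0 (m : 'X_{1..n.+1}) : 'X_[m] != 0 :> {mpoly K[n.+1]}.
Proof. by rewrite -msize_poly_eq0 msizeX. Qed.

Definition coords p (sigma : simplex n p) : {mpoly K[n.+1]} :=
  \prod_(j < p.+1) 'X_(sigma j).

Lemma coords_homog p (sigma : simplex n p) : coords sigma \is (p.+1).-homog.
Proof.
rewrite /coords mprodXE dhomogX /=; apply/eqP.
rewrite mdeg_sum (eq_bigr (fun=> 1%N)) => [|j _]; last by rewrite mdeg1.
by rewrite sum1_card card_ord.
Qed.

Lemma coords_neq0 p (sigma : simplex n p) : coords sigma != 0.
Proof. by apply/prodf_neq0 => j _; exact: mpolyX_neq0. Qed.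

(** Numerators only need to be singular at the points where the denominator does
    not vanish; by saturation this describes the same sections as the square of
    the ideal, with a condition on jets that is easy to check. *)
Definition section_of S d p (sigma : simplex n p) m F :=
  F \is (d + m * p.+1).-homog /\ forall P, P \in S ->
    ev (rep P) (coords sigma) != 0 -> double_zero (rep P) F.

Lemma is_sectionP S d p (sigma : simplex n p) s :
  is_section (double_ideal S) d sigma s <->
  exists m F, section_of S d sigma m F /\ s = tofrac F / tofrac (coords sigma) ^+ m.
Proof.
split=> [[m [F [JF hF ->]]]|[m [F [[hF F0] ->]]]].
  exists m, F; split=> //; split=> // P PS _.
  exact: double_ideal_double_zero JF PS.
have [N JF] := double_ideal_saturation (ltn0Sn p) (coords_homog sigma) hF F0.
exists (m + N)%N, (coords sigma ^+ N * F); split=> //.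
  have := dhomogM (dhomogMn N (coords_homog sigma)) hF.
  by rewrite (_ : (_ + _ = d + (m + N) * p.+1)%N) //; lia.
rewrite -/(coords sigma) rmorphM /= rmorphXn /= exprD.
by apply: frac_scale; rewrite expf_neq0 // tofrac_eq0 coords_neq0.
Qed.

Lemma section_raise S d p (sigma : simplex n p) m m' F : (m <= m')%N ->
  section_of S d sigma m F -> exists F', section_of S d sigma m' F' /\
    tofrac F / tofrac (coords sigma) ^+ m = tofrac F' / tofrac (coords sigma) ^+ m'.
Proof.
move=> mm' [hF F0]; exists (coords sigma ^+ (m' - m) * F); split; first split.
- have := dhomogM (dhomogMn (m' - m) (coords_homog sigma)) hF.
  by rewrite (_ : (_ + _ = d + m' * p.+1)%N) //; nia.
- by move=> P PS /(F0 P PS); exact: double_zeroM.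
have c0 : tofrac (coords sigma) != 0 by rewrite tofrac_eq0 coords_neq0.
rewrite rmorphM /= rmorphXn /= -[in X in _ = _ / X](subnKC mm') exprD.
by apply: frac_scale; rewrite expf_neq0.
Qed.

(** There are finitely many simplices, so one exponent serves for all of them. *)
Lemma cochain_common S d p (s : cochain K n p) :
  is_cochain (double_ideal S) d s -> exists m0, forall m, (m0 <= m)%N ->
    exists F : simplex n p -> {mpoly K[n.+1]}, forall sigma,
      section_of S d sigma m (F sigma) /\
      s sigma = tofrac (F sigma) / tofrac (coords sigma) ^+ m.
Proof.
move=> sJ; have [m mP] :=
  fin_all_exists (fun sigma => (is_sectionP _ _ _ _).1 (sJ sigma)).
exists (\max_sigma m sigma) => m' mm'.
have raised sigma : exists F, section_of S d sigma m' F /\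
    s sigma = tofrac F / tofrac (coords sigma) ^+ m'.
  have [F [secF ->]] := mP sigma.
  have /section_raise /(_ secF) [F' [secF' ->]] : (m sigma <= m')%N.
    exact: leq_trans (leq_bigmax sigma) mm'.
  by exists F'.
by have [F FP] := fin_all_exists raised; exists F.
Qed.

Definition vertex (i : 'I_n.+1) : simplex n 0 := [ffun=> i].
Definition edge (i j : 'I_n.+1) : simplex n 1 :=
  [ffun k : 'I_2 => if k == 0 then i else j].
Definition triangle (i j k : 'I_n.+1) : simplex n 2 :=
  [ffun l : 'I_3 => if l == 0 then i else if l == 1 then j else k].

Lemma vertexE (sigma : simplex n 0) : sigma = vertex (sigma 0).
Proof. by apply/ffunP=> k; rewrite ffunE ord1. Qed.

Lemma edgeE (sigma : simplex n 1) : sigma = edge (sigma 0) (sigma 1).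
Proof.
apply/ffunP=> k; rewrite ffunE; case: eqP => [->//|k0].
congr (sigma _); apply/val_inj; case: k k0 => [[|[|//]] lt] k0 //.
by case: k0; apply/val_inj.
Qed.

Lemma triangleE (sigma : simplex n 2) :
  sigma = triangle (sigma 0) (sigma 1) (sigma 2%:R).
Proof.
apply/ffunP=> k; rewrite ffunE; case: eqP => [->//|k0]; case: eqP => [->//|k1].
congr (sigma _); apply/val_inj; case: k k0 k1 => [[|[|[|//]]] lt] k0 k1 //.
  by case: k0; apply/val_inj.
by case: k1; apply/val_inj.
Qed.

Lemma coords_vertex i : coords (vertex i) = 'X_i.
Proof. by rewrite /coords big_ord1 ffunE. Qed.

Lemma coords_edge i j : coords (edge i j) = 'X_i * 'X_j.
Proof. by rewrite /coords big_ord_recl big_ord1 !ffunE. Qed.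

Lemma diff_edge (t : cochain K n 0) i j :
  cech_diff t (edge i j) = t (vertex j) - t (vertex i).
Proof.
rewrite ffunE big_ord_recl big_ord1 expr0 mul1r expr1 mulN1r.
by congr (t _ - t _); apply/ffunP=> k; rewrite !ffunE -val_eqE (ord1 k).
Qed.

Lemma diff_triangle (s : cochain K n 1) i j k :
  cech_diff s (triangle i j k) = s (edge j k) - s (edge i k) + s (edge i j).
Proof.
rewrite ffunE !big_ord_recl big_ord0 addr0 expr0 mul1r expr1 mulN1r
  sqrrN expr1n mul1r addrA.
by congr (s _ - s _ + s _); apply/ffunP=> -[[|[|//]] lt]; rewrite !ffunE -!val_eqE.
Qed.

End Sections.

(** * The first cohomology of O(d) on the plane *)

Section Monomials.

Variables (K : fieldType) (n : nat).
Implicit Types (F G A B : {mpoly K[n.+1]}) (i j k : 'I_n.+1) (m : 'X_{1..n.+1}).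

Lemma mcoeff_XnM_small i e A m : (m i < e)%N -> ('X_i ^+ e * A)@_m = 0.
Proof.
move=> mi; apply: memN_msupp_eq0; rewrite mpolyXn mulrC.
rewrite (perm_mem (msuppMX _ _)); apply/mapP=> -[m' _ mE].
by move: mi; rewrite mE mnmDE mulmnE mnm1E eqxx mul1n; lia.
Qed.

Lemma mcoeff_XnM_shift i e A m : ('X_i ^+ e * A)@_(U_(i) *+ e + m)%MM = A@_m.
Proof. by rewrite mpolyXn mulrC mcoeffMX. Qed.

Lemma divisible_Xn i e F : (forall m, (m i < e)%N -> F@_m = 0) ->
  exists G, F = 'X_i ^+ e * G.
Proof.
move=> F0; exists (\sum_(m <- msupp F) F@_m *: 'X_[m - U_(i) *+ e]).
rewrite [LHS]mpolyE mulr_sumr; apply: eq_big_seq => m; rewrite mcoeff_msupp.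
move=> Fm; rewrite -scalerAr mpolyXn -mpolyXD addmC submK //.
apply/mnm_lepP=> k; rewrite mulmnE mnm1E; case: eqP => [<-|//].
by rewrite mul1n leqNgt; apply: contra Fm => /F0 ->.
Qed.

Lemma divisible_Xn_cross i j e A B : i != j ->
  'X_j ^+ e * A = 'X_i ^+ e * B -> exists C, A = 'X_i ^+ e * C.
Proof.
move=> ij AB; apply: divisible_Xn => m mi.
rewrite -(mcoeff_XnM_shift j e) AB mcoeff_XnM_small //.
by rewrite mnmDE mulmnE mnm1E eq_sym (negbTE ij).
Qed.

(** The monomials of F outside (X_i^e, X_j^e) stay outside it when multiplied by a
    power of X_k. *)
Lemma divisible_Xn_pair i j k e A B F : i != j -> i != k -> j != k ->
    'X_k ^+ e * F = 'X_i ^+ e * A + 'X_j ^+ e * B ->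
  exists G H, F = 'X_i ^+ e * G + 'X_j ^+ e * H.
Proof.
move=> ij ik jk FAB.
pose F1 := \sum_(m <- msupp F | (e <= m i)%N) F@_m *: 'X_[m].
pose F2 := \sum_(m <- msupp F | ~~ (e <= m i)%N) F@_m *: 'X_[m].
have FE : F = F1 + F2 by rewrite [LHS]mpolyE (bigID (fun m : 'X_{1..n.+1} => e <= m i)%N).
have [G GE] : exists G, F1 = 'X_i ^+ e * G.
  apply: divisible_Xn => m mi; rewrite /F1 raddf_sum /= big1 // => m' m'i.
  rewrite mcoeffZ mcoeffX; case: eqP => [m'm|_]; last by rewrite mulr0.
  by move: m'i; rewrite m'm leqNgt mi.
have [H HE] : exists H, F2 = 'X_j ^+ e * H.
  apply: divisible_Xn => m mj; rewrite /F2 raddf_sum /= big1 // => m' m'i.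
  rewrite mcoeffZ mcoeffX; case: eqP => [m'm|_]; last by rewrite mulr0.
  rewrite m'm -ltnNge in m'i *; rewrite -(mcoeff_XnM_shift k e) FAB mcoeffD.
  by rewrite !mcoeff_XnM_small ?addr0 ?mul0r // mnmDE mulmnE mnm1E eq_sym
    ?(negbTE ik) ?(negbTE jk).
by exists G, H; rewrite [LHS]FE GE HE.
Qed.

Lemma divisible_Xn_pair_homog i j k d e A B F :
    i != j -> i != k -> j != k -> F \is (d + e).-homog ->
    'X_k ^+ e * F = 'X_i ^+ e * A + 'X_j ^+ e * B ->
  exists G H, [/\ G \is d.-homog, H \is d.-homog &
                  F = 'X_i ^+ e * G + 'X_j ^+ e * H].
Proof.
move=> ij ik jk hF /(divisible_Xn_pair ij ik jk) [G [H FGH]].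
exists (pihomog mdeg d G), (pihomog mdeg d H); split; rewrite ?pihomogP //.
rewrite -!(pihomogM _ _ (dhomog_Xin _ _ _)) -pihomogD -FGH.
by rewrite pihomog_dE.
Qed.

End Monomials.

Section FractionIdentities.

Variables (F : fieldType) (x0 x1 x2 : F).
Hypotheses (x00 : x0 != 0) (x10 : x1 != 0) (x20 : x2 != 0).

Lemma frac_triangle f01 f02 f12 :
  f02 / (x0 * x2) = f01 / (x0 * x1) + f12 / (x1 * x2) ->
  x2 * f01 = x0 * (- f12) + x1 * f02.
Proof.
move=> tri; have -> : f02 = f02 / (x0 * x2) * (x0 * x2).
  by field; rewrite x00 x20.
by rewrite tri; field; rewrite x00 x10 x20.
Qed.

Lemma frac_difference g0 g1 :
  (x0 * g1 + x1 * g0) / (x0 * x1) = g1 / x1 - (- g0) / x0.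
Proof. by field; rewrite x00 x10. Qed.

Lemma frac_glue f02 f12 g0 g1 :
  f02 / (x0 * x2) = g1 / x1 - (- g0) / x0 + f12 / (x1 * x2) ->
  x1 * (f02 - x2 * g0) = x0 * (f12 + x2 * g1).
Proof.
move=> tri; have -> : f02 = f02 / (x0 * x2) * (x0 * x2).
  by field; rewrite x00 x20.
by rewrite tri; field; rewrite x00 x10 x20.
Qed.

Lemma frac_cross f g0 g1 : g1 / x1 - g0 / x0 = f / x2 ->
  x2 * (x0 * g1 - x1 * g0) = x0 * x1 * f.
Proof.
move=> fE; have -> : f = f / x2 * x2 by field.
by rewrite -fE; field; rewrite x00 x10.
Qed.

End FractionIdentities.

Section H1.

Variables (K : fieldType).
Hypothesis charK : [pchar K] =i pred0.
Implicit Types (F G : {mpoly K[3]}) (S : {fset projpt K 2}).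

Notation X := (fun i : 'I_3 => tofrac ('X_i : {mpoly K[3]})).

Lemma X_neq0 (i : 'I_3) m : X i ^+ m != 0.
Proof. by rewrite expf_neq0 // tofrac_eq0 mpolyX_neq0. Qed.

Lemma cocycle_triangle S d (s : cochain K 2 1) i j k :
  cocycle (double_ideal S) d s -> s (edge i k) = s (edge i j) + s (edge j k).
Proof.
case=> _ /ffunP /(_ (triangle i j k)); rewrite diff_triangle ffunE => s0.
by apply/eqP; rewrite -subr_eq0 -oppr_eq0 -[X in _ == X]s0 opprB
  [s (edge i j) + _]addrC addrAC.
Qed.

(** The cocycle condition on the edges 01, 12, 02 shows that the numerator of
    s 01 is in (X_0^m, X_1^m), which splits s 01 as a difference; the
    correction then forced at vertex 2 has a pole along X_0 = 0 by one formula and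
    along X_1 = 0 by another, hence neither. *)
Lemma cocycle_splits S d (s : cochain K 2 1) : cocycle (double_ideal S) d s ->
  exists m (G : 'I_3 -> {mpoly K[3]}), (forall i, G i \is (d + m).-homog) /\
    forall i j, s (edge i j) = tofrac (G j) / X j ^+ m - tofrac (G i) / X i ^+ m.
Proof.
move=> cs; have [m0 sE] := cochain_common cs.1.
have {sE} [F FE] := sE m0 (leqnn _); exists m0; set m := m0 in FE *.
pose i0 : 'I_3 := ord0; pose i1 : 'I_3 := lift ord0 ord0.
pose i2 : 'I_3 := ord_max.
have sE i j : s (edge i j) = tofrac (F (edge i j)) / (X i ^+ m * X j ^+ m).
  by case: (FE (edge i j)) => _ ->; rewrite coords_edge rmorphM exprMn.
have hF i j : F (edge i j) \is (d + m + m).-homog.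
  by case: (FE (edge i j)) => -[+ _] _; rewrite (_ : (d + m * 2 = d + m + m)%N) //; lia.
have := cocycle_triangle i0 i1 i2 cs; rewrite !sE => tri.
have {tri} : 'X_i2 ^+ m * F (edge i0 i1) =
    'X_i0 ^+ m * (- F (edge i1 i2)) + 'X_i1 ^+ m * F (edge i0 i2).
  apply/eqP; rewrite -tofrac_eq rmorphD !rmorphM rmorphN !rmorphXn /=.
  by apply/eqP/frac_triangle; rewrite ?X_neq0.
case/(divisible_Xn_pair_homog (i := i0) (j := i1) (k := i2)
  isT isT isT (hF _ _)) => G1 [G0 [hG1 hG0 F01]].
have s01 : s (edge i0 i1) = tofrac G1 / X i1 ^+ m - tofrac (- G0) / X i0 ^+ m.
  rewrite sE F01 rmorphN rmorphD !rmorphM !rmorphXn /=.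
  by apply: frac_difference; rewrite X_neq0.
have [G2 hG2 s02] : exists2 G2 : {mpoly K[3]}, G2 \is (d + m).-homog &
    s (edge i0 i2) = tofrac G2 / X i2 ^+ m - tofrac (- G0) / X i0 ^+ m.
  have := cocycle_triangle i0 i1 i2 cs; rewrite s01 !sE => tri.
  have : 'X_i1 ^+ m * (F (edge i0 i2) - 'X_i2 ^+ m * G0) =
      'X_i0 ^+ m * (F (edge i1 i2) + 'X_i2 ^+ m * G1).
    apply/eqP; rewrite -tofrac_eq !rmorphM rmorphB rmorphD !rmorphM !rmorphXn /=.
    by apply/eqP/frac_glue; rewrite ?X_neq0 // tri rmorphN.
  case/(divisible_Xn_cross (i := i0) (j := i1) isT) => G2 G2E.
  exists G2.
    apply: homog_quotient (dhomog_Xin K i0 m) _ _.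
      by rewrite expf_neq0 // mpolyX_neq0.
    rewrite -G2E; apply: rpredB; first exact: hF.
    by have := dhomogM (dhomog_Xin K i2 m) hG0; rewrite [(m + _)%N]addnC.
  have {G2E} -> : F (edge i0 i2) = 'X_i0 ^+ m * G2 + 'X_i2 ^+ m * G0.
    by rewrite -G2E subrK.
  rewrite rmorphD !rmorphM !rmorphXn rmorphN /=.
  by apply: frac_difference; rewrite X_neq0.
pose G (i : 'I_3) := if i == i0 then - G0 else if i == i1 then G1 else G2.
have s0 i : s (edge i0 i) = tofrac (G i) / X i ^+ m - tofrac (G i0) / X i0 ^+ m.
  have [i00|ne0] := eqVneq i i0.
    rewrite i00 subrr; have := cocycle_triangle i0 i0 i0 cs => /eqP.
    by rewrite -subr_eq0 opprD addNKr oppr_eq0 => /eqP.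
  have [->|ne1] := eqVneq i i1; first exact: s01.
  have -> : i = i2; last exact: s02.
  by apply/val_inj; case: i ne0 ne1 => [[|[|[|//]]] lt].
exists G; split=> [i|i j].
  by rewrite /G; case: ifP => _; [rewrite rpredN | case: ifP].
have := cocycle_triangle i0 i j cs; rewrite !s0 => /eqP.
by rewrite [X in _ == X]addrC -subr_eq => /eqP <-; rewrite opprB addrA subrK.
Qed.

End H1.

(** * No jet relation, no first cohomology *)

Section Interpolation.

Variables (K : fieldType) (n : nat).
Implicit Types (F G : {mpoly K[n.+1]}) (S : {fset projpt K n}).

Let jet S (x : S * 'I_n.+1) F := ev (rep (val x.1)) F^`M(x.2).

Let jet_linear S x : linear (@jet S x : {mpoly K[n.+1]} -> K^o).
Proof. by move=> a F G; rewrite /jet mderivD mderivZ ev_linear. Qed.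

Let related_jet S d c : related (@jet S) d c -> (exists x, c x != 0) ->
  dependent d S.
Proof.
move=> crel [[P0 l0] c0].
pose w P := if insub P is Some P' then \row_l c (P', l) else 0.
have wE (P : S) : w (val P) = \row_l c (P, l) by rewrite /w valK.
exists w => [|F hF].
  exists (val P0); first exact: valP.
  by rewrite wE; apply/rV0Pn; exists l0; rewrite mxE.
rewrite -[RHS](crel F hF) big_seq_fsetE.
pose h P l := c (P, l) * jet (P, l) F.
rewrite [RHS](eq_bigr (fun x => h x.1 x.2)) => [|[]//]; rewrite -(pair_bigA _ h) /=.
by apply: eq_bigr => P _; rewrite wE; apply: eq_bigr => l _; rewrite mxE.
Qed.

Let jet_related S d : dependent d S ->
  exists2 c, exists x, c x != 0 & related (@jet S) d c.
Proof.
case=> w [P PS /rV0Pn [l wl]] rel.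
exists (fun x => w (val x.1) 0 x.2); first by exists ([` PS]%fset, l).
move=> F hF; rewrite -[RHS](rel F hF) big_seq_fsetE.
by rewrite -(pair_bigA _ (fun (P : S) l => w (val P) 0 l * jet (P, l) F)).
Qed.

Lemma dependent_dec d S : dependent d S \/ ~ dependent d S.
Proof.
have [[c c0 crel]|norel] := related_dec (@jet_linear S) d; [left|right].
  exact: related_jet crel c0.
by move/jet_related.
Qed.

Lemma jet_interpolation d S (b : projpt K n -> 'I_n.+1 -> K) :
    ~ dependent d S ->
  exists2 G, G \is d.-homog &
    forall P, P \in S -> forall l, ev (rep P) G^`M(l) = b P l.
Proof.
move=> indep; have [|G hG GS] :=
  unrelated_onto (@jet_linear S) (k := d) (fun x => b (val x.1) x.2).
  by case=> c c0 crel; apply: indep; exact: related_jet crel c0.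
by exists G => // P PS l; exact: GS ([` PS]%fset, l).
Qed.

End Interpolation.

Section H1.

Variables (K : fieldType).
Hypothesis charK : [pchar K] =i pred0.
Implicit Types (F G : {mpoly K[3]}) (S : {fset projpt K 2}).

Notation X := (fun i : 'I_3 => tofrac ('X_i : {mpoly K[3]})).

(** The hypothesis is the quotient rule: G has the partial derivatives of
    F / X_i^m at v. Euler's formula makes the values agree as well. *)
Lemma double_zero_jet d m i (v : 'rV[K]_3) G F : (0 < d)%N -> v 0 i != 0 ->
    F \is (d + m).-homog -> G \is d.-homog ->
    (forall l, ev v G^`M(l) = (ev v F^`M(l) -
       ev v ('X_i ^+ m)^`M(l) * (ev v F / v 0 i ^+ m)) / v 0 i ^+ m) ->
  double_zero v (F - 'X_i ^+ m * G).
Proof.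
move=> d0 vi hF hG GF; set g := ev v F / v 0 i ^+ m in GF *.
have vim : v 0 i ^+ m != 0 by rewrite expf_neq0.
have Fg : ev v F = g * v 0 i ^+ m by rewrite divfK.
have Gv : ev v G = g.
  apply: (mulfI (natr_neq0 charK d0)); rewrite -(euler _ hG) /dder.
  apply: (mulIf vim); rewrite mulr_suml.
  transitivity (dder v v F - dder v v ('X_i ^+ m) * g).
    rewrite /dder mulr_suml -sumrB; apply: eq_bigr => l _.
    by rewrite GF -!mulrA mulVf // mulr1 mulrBr !mulrA.
  rewrite (euler _ hF) (euler _ (dhomog_Xin K i m)) evX evXi Fg natrD.
  ring.
move=> l; rewrite mderivB mderivM !evB evD !evM evX evXi Gv -/g.
split; first by rewrite Fg mulrC subrr.
rewrite GF [v 0 i ^+ m * _]mulrC divfK //; ring.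
Qed.

(** Split the cocycle as the coboundary of fractions G i / X_i^m. As the cocycle
    has values in the ideal sheaf of 2S, these fractions have a well-defined jet at
    each point of S; subtracting a form H of degree d with the same jets moves them
    into the ideal sheaf and does not change the coboundary. *)
Lemma cocycle_coboundary S d (s : cochain K 2 1) : (0 < d)%N ->
    ~ dependent d S -> cocycle (double_ideal S) d s ->
  coboundary (double_ideal S) d s.
Proof.
move=> d0 indep cs; have [m [G [hG sG]]] := cocycle_splits cs.
pose vi (P : projpt K 2) : 'I_3 := odflt ord0 [pick i | rep P 0 i != 0 :> K].
have viP (P : projpt K 2) : rep P 0 (vi P) != 0.
  rewrite /vi; case: pickP => //= none.
  by have /rV0Pn [i Pi] := rep_neq0 P; have := none i; rewrite Pi.
pose b P l := (ev (rep P) (G (vi P))^`M(l) -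
  ev (rep P) ('X_(vi P) ^+ m)^`M(l) *
  (ev (rep P) (G (vi P)) / rep P 0 (vi P) ^+ m)) / rep P 0 (vi P) ^+ m.
have [H hH HS] := jet_interpolation b indep.
have GH0 P : P \in S -> double_zero (rep P) (G (vi P) - 'X_(vi P) ^+ m * H).
  by move=> PS; apply: double_zero_jet (viP P) (hG _) hH _ => // l; exact: HS.
have GH P i : P \in S -> rep P 0 i != 0 ->
    double_zero (rep P) (G i - 'X_i ^+ m * H).
  move=> PS Pi; have GHj := GH0 P PS; have Pj := viP P; set j := vi P in GHj Pj.
  apply: (@double_zero_cancel _ _ _ ('X_j ^+ m)).
    by rewrite evX evXi expf_neq0 //.
  have -> : 'X_j ^+ m * (G i - 'X_i ^+ m * H) =
      ('X_j ^+ m * G i - 'X_i ^+ m * G j) + 'X_i ^+ m * (G j - 'X_j ^+ m * H).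
    by ring.
  apply: double_zeroD; last exact: double_zeroM.
  have [m1 [F [[_ F0] sF]]] := (is_sectionP _ _ _ _).1 (cs.1 (edge j i)).
  have {}F0 : double_zero (rep P) F.
    by apply: F0 => //; rewrite coords_edge evM !evXi mulf_neq0 //.
  apply: (@double_zero_cancel _ _ _ (('X_j * 'X_i) ^+ m1)).
    by rewrite evX evM !evXi expf_neq0 // mulf_neq0 //.
  have -> : ('X_j * 'X_i) ^+ m1 * ('X_j ^+ m * G i - 'X_i ^+ m * G j) =
      ('X_j ^+ m * 'X_i ^+ m) * F.
    apply/eqP; rewrite -tofrac_eq !rmorphM rmorphB !rmorphM !rmorphXn rmorphM /=.
    move: sF; rewrite sG coords_edge rmorphM /= => sF; apply/eqP.
    by apply: frac_cross sF; rewrite ?X_neq0 // -rmorphM /= expf_neq0 // tofrac_eq0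
      mulf_neq0 // mpolyX_neq0.
  by apply: double_zeroM.
exists [ffun sigma : simplex 2 0 =>
  tofrac (G (sigma ord0)) / X (sigma ord0) ^+ m - tofrac H].
  move=> sigma; rewrite (vertexE sigma) !ffunE; set i := sigma 0.
  apply/is_sectionP; exists m, (G i - 'X_i ^+ m * H); split; first split.
  - rewrite muln1; apply: rpredB; first exact: hG.
    by have := dhomogM (dhomog_Xin K i m) hH; rewrite addnC.
  - by move=> P PS; rewrite coords_vertex evXi; exact: GH.
  rewrite coords_vertex rmorphB rmorphM rmorphXn /= mulrBl.
  by rewrite [_ * tofrac H]mulrC mulfK // X_neq0.
apply/ffunP=> sigma; rewrite (edgeE sigma) diff_edge !ffunE sG.
by rewrite opprB addrA subrK.
Qed.

End H1.

(** * A jet relation gives first cohomology *)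

Section FractionDifferences.

Variables (F : fieldType) (x y : F).
Hypotheses (x0 : x != 0) (y0 : y != 0).

Lemma frac_sub f g : g / y - f / x = (x * g - y * f) / (x * y).
Proof. by field; rewrite x0 y0. Qed.

Lemma frac_regular f g : g / y - f / x = 0 -> y * f = x * g.
Proof.
move=> fg; have -> : g = (g / y - f / x) * y + f / x * y by field; rewrite x0.
by rewrite fg; field.
Qed.

Lemma frac_scaled c a f : c * (f / x) - a / (x * y) = (c * y * f - a) / (x * y).
Proof. by field; rewrite x0 y0. Qed.

End FractionDifferences.

Section TofracIdentities.

Variables (R : idomainType) (x y : R).
Hypotheses (x0 : x != 0) (y0 : y != 0).

Let tx0 k : tofrac x ^+ k != 0. Proof. by rewrite expf_neq0 // tofrac_eq0. Qed.
Let ty0 k : tofrac y ^+ k != 0. Proof. by rewrite expf_neq0 // tofrac_eq0. Qed.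

Lemma tofrac_sub k f g :
  tofrac g / tofrac y ^+ k - tofrac f / tofrac x ^+ k =
  tofrac (x ^+ k * g - y ^+ k * f) / tofrac (x * y) ^+ k.
Proof. by rewrite rmorphB !rmorphM !rmorphXn exprMn; exact: frac_sub. Qed.

Lemma tofrac_regular k f g :
  tofrac g / tofrac y ^+ k - tofrac f / tofrac x ^+ k = 0 ->
  y ^+ k * f = x ^+ k * g.
Proof.
move/(frac_regular (tx0 k) (ty0 k)) => fg.
by apply/eqP; rewrite -tofrac_eq !rmorphM !rmorphXn fg.
Qed.

Lemma tofrac_scaled k l c a f :
  tofrac c * (tofrac f / tofrac x ^+ k) - tofrac a / tofrac x ^+ (k + l) =
  tofrac (c * x ^+ l * f - a) / tofrac x ^+ (k + l).
Proof. by rewrite rmorphB !rmorphM rmorphXn exprD; exact: frac_scaled. Qed.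

End TofracIdentities.

Section RingIdentities.

Variables (R : comNzRingType) (a b c p q x y z : R).

Lemma square_defect_difference :
  x * (p * (y - b * b)) - y * (p * (x - a * a)) =
  p * y * (a * a) - p * x * (b * b).
Proof. by ring. Qed.

Lemma square_defect_factor : p * (x * x - (x - c * q) * (x - c * q)) =
  p * c * (2%:R * x - c * q) * q.
Proof. by ring. Qed.

Lemma square_defect_approx : a * y * (p * (x - b * b)) - z - x * y * (a * p) =
  - (a * y * p) * (b * b) - z.
Proof. by ring. Qed.

Lemma sub_scaled_differences : c * (y - x) = q - p ->
  (c * y - q) - (c * x - p) = 0.
Proof.
move=> cyx; have -> : (c * y - q) - (c * x - p) = c * (y - x) - (q - p) by ring.
by rewrite cyx subrr.
Qed.

End RingIdentities.

Section H1.

Variables (K : fieldType).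
Hypothesis charK : [pchar K] =i pred0.
Implicit Types (F G : {mpoly K[3]}) (S : {fset projpt K 2}).

Notation X := (fun i : 'I_3 => tofrac ('X_i : {mpoly K[3]})).

Lemma lincomb1 p (c : 'I_1 -> K) (e : 'I_1 -> cochain K 2 p) sigma :
  lincomb c e sigma = tofrac (c 0)%:MP * e 0 sigma.
Proof. by rewrite ffunE big_ord1. Qed.

Lemma h0_pos S d F : F != 0 -> F \is d.-homog -> double_ideal S F ->
  h_geq (double_ideal S) d 0 1.
Proof.
move=> F0 hF SF; exists (fun=> [ffun=> tofrac F]) => [i|c /ffunP c0 i].
  split=> [sigma|].
    exists 0%N, F; split=> //; first by rewrite mul0n addn0.
    by rewrite ffunE expr0 divr1.
  apply/ffunP=> sigma; rewrite (edgeE sigma) diff_edge !ffunE.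
  by rewrite subrr.
have := c0 (vertex 0); rewrite lincomb1 !ffunE => /eqP.
by rewrite ord1 mulf_eq0 !tofrac_eq0 (negbTE F0) orbF mpolyC_eq0 => /eqP.
Qed.

Lemma differential_cocycle S d (t : 'I_3 -> {fraction {mpoly K[3]}})
    (s : cochain K 2 1) : is_cochain (double_ideal S) d s ->
  (forall i j, s (edge i j) = t j - t i) -> cocycle (double_ideal S) d s.
Proof.
move=> sJ st; split=> //; apply/ffunP=> sigma.
rewrite (triangleE sigma) diff_triangle !st [RHS]ffunE.
by rewrite opprB [(_ - _) + (_ - _)]addrC !subrKA subrr.
Qed.

Lemma nonzero_jet d (v w : 'rV[K]_3) : v != 0 -> w != 0 -> (0 < d)%N ->
  exists2 F : {mpoly K[3]}, F \is d.-homog & dder w v F != 0.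
Proof.
move=> v0 w0 d0; have [L hL [Lv Lw]] : exists2 L : {mpoly K[3]}, L \is 1.-homog &
    ev v L != 0 /\ ev w L != 0.
  have [L1 hL1 L1v] := nonvanishing_linform v0.
  have [L2 hL2 L2w] := nonvanishing_linform w0.
  have [L1w|L1w] := eqVneq (ev w L1) 0; last by exists L1.
  have [L2v|L2v] := eqVneq (ev v L2) 0; last by exists L2.
  exists (L1 + L2); first by rewrite rpredD.
  by rewrite !evD L1w L2v addr0 add0r.
exists (L ^+ d); first by have := dhomogMn d hL; rewrite mul1n.
by rewrite dderX (dder_hom1 _ _ hL) !mulf_neq0 ?expf_neq0 ?natr_neq0.
Qed.

(** Fractions A i / X_i^m that agree have no poles: they come from a form. *)
Lemma homog_glue d m (A : 'I_3 -> {mpoly K[3]}) : A 0 \is (d + m).-homog ->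
    (forall i j, 'X_j ^+ m * A i = 'X_i ^+ m * A j) ->
  exists2 G, G \is d.-homog & forall i, A i = 'X_i ^+ m * G.
Proof.
move=> hA AA; have [||G GE] := @divisible_Xn_cross _ _ 0 1 m (A 0) (A 1) => //.
exists G => [|i].
  apply: homog_quotient (dhomog_Xin K 0 m) _ _; last by rewrite -GE.
  by rewrite expf_neq0 // mpolyX_neq0.
apply: (mulfI (x := 'X_0 ^+ m)); first by rewrite expf_neq0 // mpolyX_neq0.
by rewrite -AA GE mulrCA.
Qed.

(** Let the relation involve P0, and let Phi be a form of degree d on whose jet at P0
    it does not vanish. With Q singular at the other points and Q = 1 at P0, the
    function 1 - (1 - Q / X_i^e)^2, suitably scaled, is 1 to second order at P0 and
    0 to second order at the other points. So the fractions u i, which are Phi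
    times it, all have the jet of Phi at P0 and zero jets elsewhere, and their
    differences are a cocycle s. If a s is a coboundary, then a u i, corrected by
    sections of the ideal sheaf, glue to a form with the jets of a Phi at P0 and 0
    elsewhere, and the relation gives a = 0. *)
Lemma h1_of_dependent S d : (0 < d)%N -> dependent d S ->
  h_geq (double_ideal S) d 1 1.
Proof.
move=> d0 [w [P0 P0S wP0] rel]; set v := rep P0.
have [Phi hPhi Phi0] := nonzero_jet (rep_neq0 P0) wP0 d0.
have [Q1 [hQ1 Q1P0 Q1S]] := separator P0 (leqnn #|` S|).
pose e := (#|` S| * 2)%N; pose Q := Q1 ^+ 2.
have hQ : Q \is e.-homog := dhomogMn 2 hQ1.
have QP0 : ev v Q = 1 by rewrite evX Q1P0 expr1n.
have QS P : P \in S -> P != P0 -> double_zero (rep P) Q.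
  by move=> PS ne; apply: double_zero_mul; exact: Q1S.
pose D i := 'X_i ^+ e - v 0 i ^+ e *: Q.
have hD i : D i \is e.-homog by rewrite rpredB ?rpredZ // dhomog_Xin.
have D0 i : ev v (D i) = 0 by rewrite evB evZ evX evXi QP0 mulr1 subrr.
have DD0 i : double_zero v (D i * D i) by exact: double_zero_mul.
pose N i := Phi * ('X_i ^+ (e + e) - D i * D i).
have hN i : N i \is (d + (e + e)).-homog.
  by rewrite dhomogM // rpredB ?dhomogM // dhomog_Xin.
have N0 P i : P \in S -> P != P0 -> double_zero (rep P) (N i).
  move=> PS ne; rewrite /N /D exprD.
  by rewrite -mul_mpolyC square_defect_factor; apply: double_zeroM; exact: QS.
pose u i := tofrac (N i) / X i ^+ (e + e).
pose s : cochain K 2 1 := [ffun sigma : simplex 2 1 => u (sigma 1) - u (sigma 0)].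
have sE i j : s (edge i j) = u j - u i by rewrite !ffunE.
have sJ : is_cochain (double_ideal S) d s.
  move=> sigma; rewrite (edgeE sigma) sE; set i := sigma 0; set j := sigma 1.
  apply/is_sectionP; exists (e + e)%N, ('X_i ^+ (e + e) * N j - 'X_j ^+ (e + e) * N i).
  split; first split.
  - rewrite (_ : (d + (e + e) * 2 = (e + e) + (d + (e + e)))%N); last by lia.
    by apply: rpredB; apply: dhomogM => //; exact: dhomog_Xin.
  - move=> P PS _; have [->|ne] := eqVneq P P0; last first.
      by apply: double_zeroB; apply: double_zeroM; exact: N0.
    rewrite square_defect_difference; apply: double_zeroB.
      by apply: double_zeroM; exact: DD0.
    by apply: double_zeroM; exact: DD0.
  by rewrite coords_edge; apply: tofrac_sub; exact: mpolyX_neq0.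
exists (fun=> s) => [_|c [t tJ /ffunP ct] i]; first exact: differential_cocycle sJ sE.
rewrite ord1; have {ct} ct k j : tofrac (c 0)%:MP * (u j - u k) =
    t (vertex j) - t (vertex k).
  by rewrite -diff_edge -ct lincomb1 sE.
move: (c 0) ct => {i}a ct.
have [m0 /(_ (e + e + m0)%N (leq_addl _ _)) [B0 BP]] := cochain_common tJ.
set m := (e + e + m0)%N in BP; pose B i := B0 (vertex i).
have hB i : B i \is (d + m).-homog.
  by case: (BP (vertex i)) => -[]; rewrite muln1.
have B_zero P i : P \in S -> rep P 0 i != 0 -> double_zero (rep P) (B i).
  move=> PS Pi; case: (BP (vertex i)) => -[_ /(_ P PS) + _]; apply.
  by rewrite coords_vertex evXi.
have tE i : t (vertex i) = tofrac (B i) / X i ^+ m.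
  by case: (BP (vertex i)) => _; rewrite coords_vertex.
pose A i := a%:MP * 'X_i ^+ m0 * N i - B i.
have AE i : tofrac a%:MP * u i - t (vertex i) = tofrac (A i) / X i ^+ m.
  by rewrite tE; apply: tofrac_scaled; exact: mpolyX_neq0.
have [||G hG AG] := @homog_glue d m A.
- have dm : (d + m)%N = (0 + m0 + (d + (e + e)))%N by rewrite /m; lia.
  apply: rpredB; last exact: hB.
  rewrite dm; apply: dhomogM (hN 0); apply: dhomogM (dhomog_Xin K 0 m0).
  by rewrite -alg_mpolyC rpredZ // dhomog1.
- move=> i j; apply: tofrac_regular; rewrite ?mpolyX_neq0 // -!AE.
  by apply: sub_scaled_differences; exact: ct.
have G_zero P : P \in S -> P != P0 -> double_zero (rep P) G.
  move=> PS ne; have [i Pi] : exists i, rep P 0 i != 0.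
    exact/rV0Pn/rep_neq0.
  apply: (@double_zero_cancel _ _ _ ('X_i ^+ m)).
    by rewrite evX evXi expf_neq0.
  rewrite -AG; apply: double_zeroB; last exact: B_zero.
  by apply: double_zeroM; exact: N0.
have G_P0 : double_zero v (G - a *: Phi).
  have [i Pi] : exists i, v 0 i != 0 by exact/rV0Pn/rep_neq0.
  apply: (@double_zero_cancel _ _ _ ('X_i ^+ m)).
    by rewrite evX evXi expf_neq0.
  rewrite mulrBr -AG -mul_mpolyC /A /N /m ['X_i ^+ (_ + m0)]exprD.
  rewrite square_defect_approx.
  by apply: double_zeroB; [exact: double_zeroM | exact: B_zero].
have := rel G hG; rewrite (big_fsetD1 P0) //= big_seq big1 ?addr0 => [|P].
  have := double_zero_dder (w P0) G_P0; rewrite dderB dderZ => /eqP.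
  rewrite subr_eq0 => /eqP -> /eqP; rewrite mulf_eq0 (negbTE Phi0) orbF.
  by move/eqP.
case/fsetD1P=> ne PS; exact: double_zero_dder (G_zero P PS ne).
Qed.

Theorem h1_dependent S d : (0 < d)%N ->
  h_geq (double_ideal S) d 1 1 <-> dependent d S.
Proof.
move=> d0; split=> [[s sJ s_indep]|]; last exact: h1_of_dependent.
have [//|indep] := dependent_dec d S.
have sb : coboundary (double_ideal S) d (lincomb (fun=> 1) s).
  have -> : lincomb (fun=> 1) s = s 0.
    by apply/ffunP=> sigma; rewrite lincomb1 rmorph1 mul1r.
  exact: cocycle_coboundary (sJ 0).
by have /eqP := s_indep _ sb 0; rewrite oner_eq0.
Qed.

End H1.

(** * Lines and conics through points *)

Section Lines.

Variables (K : fieldType).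
Implicit Types (F G L C D : {mpoly K[3]}) (W : {vspace 'rV[K]_3}).
Implicit Types (S A B : {fset projpt K 2}).

Definition zero_line L : {vspace 'rV[K]_3} :=
  lker (linfun (fun v : 'rV[K]_3 => ev v L : K^o)).

Lemma mem_zero_line L v : L \is 1.-homog -> (v \in zero_line L) = (ev v L == 0).
Proof.
case/homog1_linform=> c ->.
pose f (v : 'rV[K]_3) : K^o := ev v (linform c).
have f_lin : linear f.
  move=> a u v'; rewrite /f !ev_linform scaler_sumr -big_split /=.
  by apply: eq_bigr => k _; rewrite !mxE mulrDr mulrCA.
pose fL := HB.pack_for {linear 'rV[K]_3 -> K^o} f (GRing.isLinear.Build _ _ _ _ f f_lin).
rewrite /zero_line (_ : (fun v0 => _) = fL) // memv_ker.
by rewrite lfunE.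
Qed.

Lemma zero_line_is_line L : L \is 1.-homog -> L != 0 -> is_line (zero_line L).
Proof.
move=> hL L0; pose phi := linfun (fun v : 'rV[K]_3 => ev v L : K^o).
have := limg_ker_dim phi fullv; rewrite capfv dimvf dim_rV => dims.
have := dimvS (subvf (limg phi)); rewrite dimvf => img1.
have {}img1 : (\dim (limg phi) <= 1)%N by [].
have ne3 : \dim (zero_line L) != 3%N.
  apply: contraNneq L0 => dim3.
  have full : zero_line L = fullv.
    by apply/eqP; rewrite eqEdim subvf dim3 dimvf dim_rV.
  case/homog1_linform: (hL) => c Lc; rewrite Lc linform_eq0.
  apply/eqP/rowP=> k; rewrite mxE; have : delta_mx 0 k \in zero_line L.
    by rewrite full memvf.
  rewrite mem_zero_line // Lc ev_linform (bigD1 k) //= mxE !eqxx mulr1.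
  rewrite big1 => [|j jk]; first by rewrite addr0 => /eqP.
  by rewrite mxE (negbTE jk) andbF mulr0.
rewrite /is_line; change (\dim (lker phi) = 2%N).
change (is_true (\dim (lker phi) != 3%N)) in ne3.
by move: dims img1 ne3; move: (\dim (lker phi)) (\dim (limg phi)) => k m; lia.
Qed.

(** Fewer than three conditions on three coefficients. *)
Lemma form_on_subspace W : (\dim W < 3)%N -> exists L,
  [/\ L \is 1.-homog, L != 0 & forall v, v \in W -> ev v L = 0].
Proof.
move=> dimW; pose f (i : 'I_(\dim W)) F := ev (vbasis W)`_i F.
have [|L [hL L0 LW]] := @form_common_zero _ 2 _ f (fun i => @ev_linear _ _ _) 1.
  by rewrite card_ord.
exists L; split=> // v vW; apply/eqP; rewrite -mem_zero_line //.
rewrite (coord_vbasis vW); apply: memv_suml => i _; apply: memvZ.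
by rewrite mem_zero_line //; apply/eqP/LW.
Qed.

Lemma span_form S L : lin_span S = fullv -> L \is 1.-homog ->
  (forall P, P \in S -> ev (rep P) L = 0) -> L = 0.
Proof.
move=> spanS hL LS; apply/eqP; apply: contraT => L0.
have : (lin_span S <= zero_line L)%VS.
  rewrite /lin_span big_seq; apply: (big_ind (fun U => U <= zero_line L)%VS).
  - exact: sub0v.
  - by move=> U V UL VL; rewrite subv_add UL.
  move=> P PS; rewrite val_rep -memvE mem_zero_line //; exact/eqP/LS.
move/dimvS; rewrite spanS (zero_line_is_line hL L0) dimvf dim_rV.
by [].
Qed.

Lemma not_span_form S : lin_span S != fullv -> exists L,
  [/\ L \is 1.-homog, L != 0 & forall P, P \in S -> ev (rep P) L = 0].
Proof.
move=> spanS; have [|L [hL L0 LS]] := @form_on_subspace (lin_span S).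
  rewrite ltnNge; apply: contraNN spanS => dim3.
  by rewrite eqEdim subvf dimvf dim_rV.
exists L; split=> // P PS; apply: LS.
have: (val P <= lin_span S)%VS.
  by rewrite /lin_span (big_fsetD1 P) //= addvSl.
by rewrite val_rep memvE.
Qed.

Lemma union_of_zero_lines L M : L \is 1.-homog -> L != 0 ->
    M \is 1.-homog -> M != 0 ->
  is_union_of_lines (M * L) (zero_line L) (zero_line M).
Proof.
move=> hL L0 hM M0; split; [exact: zero_line_is_line.. | move=> P].
rewrite (vanishes_rep P (dhomogM hM hL)) !on_subspace_rep !mem_zero_line // evM.
split=> [/eqP|]; first by rewrite mulf_eq0 => /orP[]->; [right|left].
by case=> /eqP ->; rewrite ?mulr0 ?mul0r.
Qed.

Lemma fsubset_of_card (T : choiceType) (B : {fset T}) k : (k <= #|` B|)%N ->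
  exists2 B', (B' `<=` B)%fset & #|` B'| = k.
Proof.
move=> kB; exists [fset x in take k (enum_fset B)]%fset.
  by apply/fsubsetP=> x; rewrite inE /= => /mem_take.
by rewrite card_fseq undup_id ?take_uniq ?fset_uniq // size_takel.
Qed.

(** Three points on a line impose independent conditions on conics, so by dimension
    the conics through them are the multiples of the line. *)
Lemma conic_component D L B : D \is 2.-homog -> L \is 1.-homog -> L != 0 ->
    (2 < #|` B|)%N ->
    (forall P, P \in B -> ev (rep P) D = 0 /\ ev (rep P) L = 0) ->
  exists2 M, M \is 1.-homog & D = M * L.
Proof.
move=> hD hL L0 /fsubset_of_card [B' /fsubsetP B'B cardB'] DL.
pose f (P : B') F := ev (rep (val P)) F.
have dims : ('C(1 + 2, 1) + #|{: B'}|)%N = 'C(2 + 2, 2) by rewrite -cardfE cardB'.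
apply: (@unrelated_multiple _ 2 _ f (fun P => @ev_linear _ _ _) 1 1 2 L D
  hL L0 erefl dims) => // [[c [P cP] crel]|A _ P|P].
- have [t _ tP] := fin_all_exists2 (fun P : B' => tangent_direction 0 (rep (val P))).
  pose r (Q : B') := (c Q, 0 : K).
  have rr : relation (fun Q : B' => rep (val Q)) t 2 r.
    move=> F hF; rewrite -[RHS](crel F hF); apply: eq_bigr => Q _.
    by rewrite mul0r addr0.
  have p_inj (Q Q' : B') : Q != Q' -> ~~ (rep (val Q) <= rep (val Q'))%MS.
    exact: rep_inj.
  have : len r = 0%N.
    apply: short_relation rr _ => // [Q|]; first exact: rep_neq0.
    rewrite -cardB' cardfE -sum1_card; apply: leq_sum => Q _.
    by rewrite /local_len eqxx /=; case: (_ == _).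
  by move/eqP/len_eq0P=> /(_ P) [] /eqP; rewrite (negbTE cP).
- by rewrite /f evM; case: (DL _ (B'B _ (valP P))) => _ ->; rewrite mulr0.
- by case: (DL _ (B'B _ (valP P))).
Qed.

End Lines.

(** * Minimally Terracini sets *)

Section MinimallyTerracini.

Variables (K : fieldType).
Hypothesis charK : [pchar K] =i pred0.
Variables (d : nat).
Hypothesis d_ge4 : (4 <= d)%N.
Implicit Types (F G L C D : {mpoly K[3]}).
Implicit Types (S A B : {fset projpt K 2}).

Let d_gt0 : (0 < d)%N. Proof. exact: leq_trans d_ge4. Qed.

(** Forms of degree d restrict to a line as a space of dimension d + 1. *)
Lemma line_dependent L B : L \is 1.-homog -> L != 0 ->
    (forall P, P \in B -> ev (rep P) L = 0) -> (d.+1 < #|` B|.*2)%N ->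
  dependent d B.
Proof.
move=> hL L0 BL cardB; have -> : d = (d.-1 + 1)%N by rewrite addn1 prednK.
apply: (curve_dependent charK hL) => //; first by rewrite addn1.
by rewrite addn1 bin_formsS; lia.
Qed.

(** Forms of degree d restrict to a conic as a space of dimension 2 d + 1. *)
Lemma conic_dependent C B : C \is 2.-homog -> C != 0 ->
    (forall P, P \in B -> ev (rep P) C = 0) -> (d < #|` B|)%N ->
  dependent d B.
Proof.
move=> hC C0 BC cardB; have -> : d = (d - 2 + 2)%N by rewrite subnK //; lia.
apply: (curve_dependent charK hC) => //; first by rewrite addn2.
have -> : 'C(d - 2 + 2 + 2, d - 2 + 2) = 'C((d - 2).+2 + 2, (d - 2).+2).
  by rewrite !addn2.
by rewrite !bin_formsS; lia.
Qed.

Section Minimal.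

Variables (x : nat) (S : {fset projpt K 2}).
Hypothesis minS : min_terracini d x S.

Lemma min_card : #|` S| = x. Proof. by case: minS => -[]. Qed.

Lemma min_independent A : (A `<` S)%fset -> ~ dependent d A.
Proof.
case: minS => _ min /min [_ h1] /(h1_dependent charK A d_gt0).2.
exact: h1.
Qed.

Lemma min_dependent : dependent d S.
Proof. by case: minS => -[_ _ h1 _] _; apply/h1_dependent. Qed.

Lemma min_neq0 : S != fset0.
Proof. by case: min_dependent => w [P PS _] _; apply/fset0Pn; exists P. Qed.

(** The support of the relation is dependent, so by minimality it is S. *)
Lemma min_full_dependent : full_dependent d S.
Proof.
have [B [BS B0 Bfull]] := dependent_full min_dependent.
have [<-//|ne] := eqVneq B S.
case: (@min_independent B); first by rewrite fproperEneq ne.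
exact: full_dependent_sub Bfull B0 (fsubset_refl B).
Qed.

Lemma min_not_collinear L : L \is 1.-homog ->
  (forall P, P \in S -> ev (rep P) L = 0) -> L = 0.
Proof. by case: minS => -[_ _ _ spanS] _; apply: span_form. Qed.

Lemma min_line L B : L \is 1.-homog -> L != 0 -> (B `<=` S)%fset ->
  (forall P, P \in B -> ev (rep P) L = 0) -> (#|` B|.*2 <= d.+1)%N.
Proof.
move=> hL L0 BS BL; rewrite leqNgt; apply/negP=> /(line_dependent hL L0 BL).
apply: min_independent; rewrite fproperEneq BS andbT.
by apply: contraNneq L0 => BE; apply/eqP/min_not_collinear; rewrite // -BE.
Qed.

(** The points take part in a relation on a scheme of length at most 2 x < 3 d, so
    they lie on a conic. With at most d points, they would lie on a line; with d + 2
    or more, removing one leaves at least d + 1 points on the conic, and these are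
    already dependent. *)
Lemma min_conic : (2 * x < 3 * d)%N -> x = d.+1 /\
  exists C, [/\ C \is 2.-homog, C != 0 & forall P, P \in S -> ev (rep P) C = 0].
Proof.
rewrite -min_card => small.
have [C [hC C0 CS]] := full_dependent_conic charK d_gt0 min_full_dependent small.
split; last by exists C.
apply/eqP; rewrite eqn_leq; apply/andP; split; last first.
  rewrite ltnNge; apply/negP=> /(full_dependent_line charK d_gt0 min_full_dependent).
  by case=> L [hL /eqP L0 LS]; apply: L0; exact: min_not_collinear.
have /fset0Pn [P PS] := min_neq0.
rewrite leqNgt; apply/negP=> big.
have SP : (S `\ P `<` S)%fset by rewrite fproperD1.
apply: (min_independent SP); apply: (conic_dependent hC C0) => [Q|].
  by case/fsetD1P=> _; exact: CS.
by move: big; rewrite (cardfsD1 P) PS add1n ltnS.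
Qed.

(** A multiple factor of a conic is a double line, which would contain S. *)
Lemma min_reduced C : C \is 2.-homog -> C != 0 ->
  (forall P, P \in S -> ev (rep P) C = 0) -> reduced_conic C.
Proof.
move=> hC C0 CS; split=> // G H CGH; rewrite leqNgt; apply/negP=> G2.
have [G0 H0] : G != 0 /\ H != 0.
  by move: C0; rewrite CGH mulf_eq0 negb_or expf_eq0 /= => /andP[].
have sizeC : (msize C).-1 = 2%N.
  exact: dhomog_uniq C0 (dhomog_msize hC) hC.
have [sizeG sizeH] : msize G = 2%N /\ msize H = 1%N.
  move: sizeC; rewrite CGH msizeM ?expf_neq0 // expr2 msizeM //.
  have : (0 < msize H)%N by rewrite lt0n msize_poly_eq0.
  have : (1 < msize G)%N by [].
  by move: (msize G) (msize H) => g h; lia.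
have [c c0 Hc] : exists2 c, c != 0 & H = c%:MP.
  by apply/msize_poly1P; rewrite sizeH.
have GS P : P \in S -> vanishes_at G P.
  move=> PS v vP; have := (vanishes_rep P hC).2 (CS P PS) v vP.
  rewrite CGH Hc mevalM mevalC rmorphXn /= => /eqP.
  by rewrite mulf_eq0 (negbTE c0) orbF expf_eq0 /= => /eqP.
have /fset0Pn [P PS] := min_neq0.
(* Vanishing on a line through the origin includes the origin, so that G has no
   constant term and is a linear form. *)
have G00 : G@_0 = 0.
  have -> : G@_0 = ev 0 G.
    elim/mpoly_ring_ind: G {CGH G2 G0 sizeG GS} => [a|i|F1 F2 e1 e2|F1 F2 e1 e2].
    - by rewrite mcoeffC eqxx mulr1 /ev mevalC.
    - by rewrite evXi mxE mcoeffX mnm1_eq0.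
    - by rewrite mcoeffD e1 e2 evD.
    - by rewrite rmorphM /= e1 e2 evM.
  by apply: GS PS _ _; exact: mem0v.
have hG : G \is 1.-homog.
  apply/dhomogP=> m mG; have := msize_mdeg_lt mG; rewrite sizeG ltnS.
  case: (posnP (mdeg m)) => [/eqP|m0 m1]; last by apply/eqP; rewrite eqn_leq m1.
  rewrite mdeg_eq0 => /eqP m0; move: mG.
  by rewrite m0 mcoeff_msupp G00 eqxx.
case/eqP: G0; apply: (min_not_collinear hG) => Q /GS.
exact: (vanishes_rep Q hG).1.
Qed.

(** Each line contains at most (d + 1) / 2 points, and together they contain d + 1:
    equality holds and no point is counted twice. *)
Lemma min_evenly_split D : x = d.+1 -> contained_in S D -> evenly_split d S D.
Proof.
move=> xd SD R L [lineR lineL DRL].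
set BR := [fset P in S | on_subspace R P]%fset.
set BL := [fset P in S | on_subspace L P]%fset.
have card_line W : is_line W -> (#|` [fset P in S | on_subspace W P]%fset|.*2 <= d.+1)%N.
  move=> dimW; have [|M [hM M0 MW]] := @form_on_subspace _ W.
    by rewrite dimW.
  apply: (min_line hM M0); first by apply/fsubsetP=> P; rewrite !inE => /andP[].
  by move=> P; rewrite !inE on_subspace_rep => /andP[_ /MW].
have cR := card_line R lineR; have cL := card_line L lineL.
have cU : #|` (BR `|` BL)%fset| = d.+1.
  rewrite -xd -min_card; congr #|` _|; apply/fsetP=> P; rewrite !inE -andb_orr.
  by rewrite andb_idr // => PS; apply/orP/DRL/SD.
have := cardfsUI BR BL; rewrite cU -/BR -/BL in cR cL * => cards.
have RE : #|` BR|.*2 = d.+1 by lia.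
have LE : #|` BL|.*2 = d.+1 by lia.
have IE : #|` (BR `&` BL)%fset| = 0%N by lia.
split.
- by have := congr1 odd RE; rewrite odd_double oddS; case: odd.
- by rewrite -RE doubleK.
- by rewrite -LE doubleK.
- apply/fsetP=> P; have /fsetP/(_ P) := cardfs0_eq IE; rewrite !inE => <-.
  by case: (P \in S).
Qed.

End Minimal.

(** With three or more points on it, a line is a component of D, and the even
    splitting bounds its number of points. *)
Lemma split_conic_line S D L : #|` S| = d.+1 -> D \is 2.-homog -> D != 0 ->
    (forall P, P \in S -> ev (rep P) D = 0) -> evenly_split d S D ->
    L \is 1.-homog -> L != 0 ->
  forall B, (B `<=` S)%fset -> (forall P, P \in B -> ev (rep P) L = 0) ->
  (#|` B|.*2 <= d.+1)%N.
Proof.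
move=> cardS hD D0 SD split_D hL L0 B /fsubsetP BS BL.
rewrite leqNgt; apply/negP=> big.
have [|P PB|M hM DM] := @conic_component _ D L B hD hL L0; first by lia.
  by split; [exact/SD/BS | exact: BL].
have M0 : M != 0 by apply: contraNneq D0 => M0; rewrite DM M0 mul0r.
have := union_of_zero_lines hL L0 hM M0; rewrite -DM => /split_D [_ cardL _ _].
have : (#|` B| <= #|` [fset P in S | on_subspace (zero_line L) P]%fset|)%N.
  apply/fsubset_leq_card/fsubsetP=> P PB.
  by rewrite !inE BS //= on_subspace_rep mem_zero_line // BL.
have : (d.+1./2.*2 <= d.+1)%N.
  by rewrite -[X in (_ <= X)%N]odd_double_half leq_addl.
by rewrite cardL; move: big; move: (d.+1./2) => h; lia.
Qed.

(** D times a form through S is in the square of the ideal, and S is dependent for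
    dimension reasons. Dependent subsets of at most d points, and S if it does not
    span, would put too many points on a line. *)
Lemma min_of_conic S D : #|` S| = d.+1 -> D \is 2.-homog -> D != 0 ->
  (forall P, P \in S -> ev (rep P) D = 0) -> evenly_split d S D ->
  min_terracini d d.+1 S.
Proof.
move=> cardS hD D0 SD split_D; have on_line_le := split_conic_line cardS hD D0 SD split_D.
have SI : vanishing_ideal S D by exact: vanishing_ideal_homog hD SD.
split.
  split=> //.
  - pose f (P : S) F := ev (rep (val P)) F.
    have [|G [hG G0 GS]] := @form_common_zero _ 2 _ f (fun P => @ev_linear _ _ _) (d - 2).
      rewrite -cardfE cardS (_ : d - 2 = (d - 4).+2)%N; last by lia.
      by rewrite !bin_formsS; have := bin_gt0 (d - 4 + 2) (d - 4); lia.
    apply: (@h0_pos _ _ _ (D * G)); first by rewrite mulf_neq0.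
      by rewrite (_ : d = (2 + (d - 2))%N) ?dhomogM //; lia.
    apply: ideal_mul_base => //; apply: (vanishing_ideal_homog hG) => P PS.
    exact: GS [` PS]%fset.
  - by apply/h1_dependent => //; apply: conic_dependent hD D0 SD _; rewrite cardS.
  - apply/eqP; apply: contraT => /not_span_form [L [hL L0 LS]].
    have := on_line_le L hL L0 S (fsubset_refl S) LS; rewrite cardS; lia.
move=> A AS; split.
  by exists (fun i => 0) => [[]|c _ []].
move=> /(h1_dependent charK A d_gt0) /dependent_full [B [BA B0 Bfull]].
have cardB : (#|` B| <= d)%N.
  by rewrite -ltnS -cardS; apply: fproper_ltn_card; apply: fsub_proper_trans AS.
have [L [hL L0 LB]] := full_dependent_line charK d_gt0 Bfull cardB.
have := full_dependent_card charK d_gt0 Bfull B0.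
have := on_line_le L hL L0 B _ LB; rewrite (fsubset_trans BA (fproper_sub AS)).
by move=> /(_ isT); lia.
Qed.

End MinimallyTerracini.

Local Open Scope fset_scope.

Theorem proposition5p2 (K : closedFieldType) (charK : [pchar K] =i pred0)
    (x d : nat) (x_gt0 : (0 < x)%N) (d_ge4 : (4 <= d)%N) :
  [/\ (* (a) *)
      (x <= d)%N -> forall S : {fset projpt K 2}, ~ min_terracini d x S,
      (* (b) *)
      forall S : {fset projpt K 2}, #|` S| = d.+1 ->
        (min_terracini d d.+1 S <->
          exists D : {mpoly K[3]},
            [/\ reduced_conic D, contained_in S D & evenly_split d S D]) /\
        (min_terracini d d.+1 S ->
          forall D : {mpoly K[3]},
            reduced_conic D -> contained_in S D -> evenly_split d S D)
    & (* (c) *)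
      (5 <= d)%N -> (d + 2 <= x)%N -> (2 * x < 3 * d)%N ->
        forall S : {fset projpt K 2}, ~ min_terracini d x S].
Proof.
split=> [x_le S minS|S cardS|_ x_ge x_lt S minS].
- have [|xd _] := min_conic charK d_ge4 minS; first by lia.
  by rewrite xd ltnn in x_le.
- split; last by move=> minS D _ SD; exact: (min_evenly_split charK d_ge4 minS).
  split=> [minS|[D [[D0 hD _] SD split_D]]].
    have [|_ [C [hC C0 CS]]] := min_conic charK d_ge4 minS; first by lia.
    have SC : contained_in S C by exact: vanishing_ideal_homog hC CS.
    exists C; split=> //; first exact: (min_reduced charK d_ge4 minS).
    exact: (min_evenly_split charK d_ge4 minS).
  apply: (min_of_conic charK d_ge4 cardS hD D0 _ split_D) => P PS.
  by apply/(vanishes_rep P hD)/SD.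
- have [//|xd _] := min_conic charK d_ge4 minS.
  by rewrite xd addn2 ltnn in x_ge.
Qed.
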